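(* For every integer $m\ge 1$ there exists a constant $C(m)$, depending only on $m$, such that the following holds. Let $N,d_1,d_2$ be positive integers with $d_1>d_2$, and put $n=N^{d_1}$, $p=N^{d_2}$. Then for all $A_1',\ldots,A_m',B_1',\ldots,B_m'\in M_n(\mathbb{C})\otimes M_p(\mathbb{C})$ of operator norm less than $1$, $$\left\|\mathbb{E}\left[(\mathrm{tr}\otimes\mathrm{Id}_p)(A_1'\check B_1\cdots A_m'\check B_m)-(\tau\otimes\mathrm{Id}_p)(A_1'\bar B_1\cdots A_m'\bar B_m)\right]\right\|\le C(m)\,N^{-d_1+d_2}.$$
   Context: $X$ is an $n\times n$ Ginibre matrix: its entries are i.i.d. complex Gaussian with mean $0$ and variance $1/n$ (so $\mathbb{E}[X_{ab}^2]=0$, $\mathbb{E}[|X_{ab}|^2]=1/n$). $\check B_i=(X\otimes I_p)B_i'(X^*\otimes I_p)\in M_n(\mathbb{C})\otimes M_p(\mathbb{C})$. $\mathrm{tr}$ is the normalized trace on $M_n(\mathbb{C})$, and $\mathrm{Id}_p$ is the identity map on $M_p(\mathbb{C})$. $c$ is a circular element with $\tau(cc^* )=1$, $*$-free from $M_n(\mathbb{C})$, in the free product $(M_n(\mathbb{C})*\mathbb{C}\langle c\rangle,\tau)$, where $\mathbb{C}\langle c\rangle$ denotes the $*$-algebra generated by $c$ and $\tau$ is the free product trace, which restricts to $\mathrm{tr}$ on $M_n(\mathbb{C})$. $\bar B_i=(c\otimes I_p)B_i'(c^*\otimes I_p)\in(M_n(\mathbb{C})*\mathbb{C}\langle c\rangle)\otimes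 M_p(\mathbb{C})$, and $A_i'$ is viewed in the same algebra via $M_n(\mathbb{C})\subset M_n(\mathbb{C})*\mathbb{C}\langle c\rangle$. The expectation is over $X$; the outer norm is the operator norm on $M_p(\mathbb{C})$. *)

(* Defs.v *)
From HB Require Import structures.
From mathcomp Require Export all_boot all_order all_algebra.
From mathcomp Require Export complex.
From mathcomp Require Export all_classical all_reals all_analysis.

Set Implicit Arguments.
Unset Strict Implicit.
Unset Printing Implicit Defensive.

Import Order.TTheory GRing.Theory Num.Theory.

Local Open Scope classical_set_scope.
Local Open Scope ring_scope.
Local Open Scope sesquilinear_scope.

(* The algebra S (x) M_p(C) is represented as 'M[S]_p: the matrix with entry s
   at (k, l) and 0 elsewhere is s (x) E_kl.  Thus s (x) I_p is s%:M, and for a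
   linear map f the map f (x) Id_p is map_mx f. *)

Section OperatorNorm.
Variable R : realType.

Definition l2norm k (v : 'cV[R[i]]_k) : R :=
  Num.sqrt (\sum_(j < k) Normc.normc (v j 0) ^+ 2).

Definition opnorm k (M : 'M[R[i]]_k) : R :=
  sup [set l2norm (M *m v) | v in [set v : 'cV_k | l2norm v <= 1]].

(* M acts on C^n (x) C^p, the direct sum of p copies of C^n. *)
Definition block_opnorm n p (M : 'M['M[R[i]]_n]_p) : R :=
  opnorm (\mxblock_(k < p, l < p) M k l).

End OperatorNorm.

Definition ntr (R : realType) n (M : 'M[R[i]]_n) : R[i] := n%:R^-1 * \tr M.

Section Probability.
Context {d : measure_display} {T : measurableType d} {R : realType}.
Variable P : probability T R.

Definition Ecomplex (f : T -> R[i]) : R[i] :=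
  Complex (fine ('E_P[fun w => complex.Re (f w)])%E)
          (fine ('E_P[fun w => complex.Im (f w)])%E).

Definition Emx p (F : T -> 'M[R[i]]_p) : 'M[R[i]]_p :=
  \matrix_(k, l) Ecomplex (fun w => F w k l).

Definition mutually_independent (I : finType) (Y : I -> T -> R) : Prop :=
  forall E : I -> set R, (forall k, measurable (E k)) ->
    P (\bigcap_(k in setT) (Y k @^-1` E k)) =
    (\prod_(k : I) P (Y k @^-1` E k))%E.

Definition entry_part n (X : T -> 'M[R[i]]_n) (k : 'I_n * 'I_n * bool) (w : T)
    : R :=
  let z := X w k.1.1 k.1.2 in if k.2 then complex.Re z else complex.Im z.

(* A centered complex Gaussian z with E[z^2] = 0 and E[|z|^2] = 1/n has
   independent real and imaginary parts of law N(0, 1/(2n)); the second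
   argument of normal_prob is the standard deviation. *)
Record ginibre n (X : T -> 'M[R[i]]_n) : Prop := Ginibre {
  ginibre_measurable : forall k, measurable_fun setT (entry_part X k) ;
  ginibre_normal : forall k (E : set R), measurable E ->
    P (entry_part X k @^-1` E) = normal_prob 0 (Num.sqrt (2 * n%:R)^-1) E ;
  ginibre_independent : mutually_independent (entry_part X)
}.

End Probability.

Section FreeProbability.
Variables (R : realType) (A : algType R[i]) (star : A -> A) (tau : {scalar A}).

Record star_probability_space : Prop := StarProbabilitySpace {
  starK : involutive star ;
  star_antilinear : forall (z : R[i]) (x y : A),
    star (z *: x + y) = z^* *: star x + star y ;
  starM : forall x y, star (x * y) = star y * star x ;
  tau1 : tau 1 = 1 ;
  tau_tracial : forall x y, tau (x * y) = tau (y * x) ;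
  tau_ge0 : forall x, 0 <= tau (star x * x)
}.

Record unital_star_subalgebra (S : set A) : Prop := UnitalStarSubalgebra {
  subalg_1 : S 1 ;
  subalg_lin : forall (z : R[i]) (x y : A), S x -> S y -> S (z *: x + y) ;
  subalg_mul : forall x y, S x -> S y -> S (x * y) ;
  subalg_star : forall x, S x -> S (star x)
}.

Definition star_alg (G : set A) : set A := smallest unital_star_subalgebra G.

(* Freeness of a family of unital subalgebras; a word is a sequence of pairs
   (index of the subalgebra, element). *)
Definition free_family (I : eqType) (S : I -> set A) : Prop :=
  forall w : seq (I * A), w != [::] ->
    (forall x, x \in w -> S x.1 x.2 /\ tau x.2 = 0) ->
    sorted [rel x y | x.1 != y.1] w ->
    tau (\prod_(x <- w) x.2) = 0.

Definition star_free (G1 G2 : set A) : Prop :=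
  free_family (fun b : bool => if b then star_alg G1 else star_alg G2).

Definition semicircle_moment (k : nat) : R :=
  (2 * pi)^-1 *
  (\int[lebesgue_measure]_(x in `[- 2%R, 2%R]) (x ^+ k * Num.sqrt (4 - x ^+ 2))).

Definition semicircular (s : A) : Prop :=
  star s = s /\ forall k : nat, tau (s ^+ k) = (semicircle_moment k)%:C%C.

(* The normalization is the one with tau (c c^* ) = 1. *)
Definition circular (c : A) : Prop :=
  exists s1 s2 : A,
    [/\ semicircular s1, semicircular s2, star_free [set s1] [set s2]
      & c = ((Num.sqrt 2)^-1)%:C%C *: (s1 + 'i%C *: s2)].

(* (A, tau) is the free product (M_n(C) * C<c>, tau): the unital *-algebra A is
   generated by a copy iota of M_n(C), on which tau is the normalized trace,
   and a circular c which is *-free from it. These requirements determine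
   (A, star, tau, iota, c) up to isomorphism, since tau is then faithful. *)
Record circular_free_product n (iota : {rmorphism 'M[R[i]]_n -> A}) (c : A)
    : Prop := CircularFreeProduct {
  cfp_space : star_probability_space ;
  cfp_scalable : scalable iota ;
  cfp_star : forall M : 'M[R[i]]_n, iota (M^t* ) = star (iota M) ;
  cfp_tr : forall M : 'M[R[i]]_n, tau (iota M) = ntr M ;
  cfp_circular : circular c ;
  cfp_free : star_free (range iota) [set c] ;
  cfp_generated : star_alg (range iota `|` [set c]) = setT
}.

End FreeProbability.

Definition check_mx (R : realType) n p (X : 'M[R[i]]_n)
    (B : 'M['M[R[i]]_n]_p) : 'M['M[R[i]]_n]_p :=
  X%:M *m B *m (X^t* )%:M.

Definition bar_mx (R : realType) (A : algType R[i]) (star : A -> A) n p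
    (iota : {rmorphism 'M[R[i]]_n -> A}) (c : A) (B : 'M['M[R[i]]_n]_p)
    : 'M[A]_p :=
  c%:M *m map_mx iota B *m (star c)%:M.

(* Main.v *)
Require Import Defs.
From mathcomp Require Import zify ring lra.
From mathcomp Require Import measurable_realfun.
Import Order.TTheory GRing.Theory Num.Theory.
Local Open Scope ring_scope.

Set Implicit Arguments.
Unset Strict Implicit.
Unset Printing Implicit Defensive.

(* Expand both sides as words in the letters x and x^*, read from left to right
   with a stack of open letters.  Gaussian integration by parts gives a recursion
   for the expectation: a new letter stays open, closes the innermost open letter,
   or closes a deeper one.  The Wick words of the circular element satisfy the same
   recursion without the last case, and their traces vanish by freeness together
   with the orthogonality of 1 to the Chebyshev polynomials for the semicircle law.
   A contraction of the last kind produces a partial transpose in M_n (x) M_p, of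
   norm at most p, against a factor 1/n: two Cauchy-Schwarz estimates, for the open
   letters on the left and on the right, bound its contribution by O(p/n). *)

(** A letter takes 2n^2 values, so a sum over the values of the open letters can never be bounded
    term by term. What is controlled is a sum of squared norms over all values: the product of k
    open letters contributes (2n)^k, while to its right each of them is closed by a letter of weight
    1/(2n), which gives (2n)^-k times a constant free of n and p. The dimensions cancel between the
    two sides, and every estimate is normalized to keep this balance. In a crossing contraction the
    innermost open letter stays open inside the partial trace. Summing over its values also sums
    over the two indices that it fixes, and this is where the matrix behind it shows up partially
    transposed. The error is collected where the crossing occurs, and the rest of the word is
    estimated by the general bound, so the ratio p/n enters exactly once. *)

Section Dels.
Variable K : finType.

(** Positions, not values, are singled out: equal letters are removed once per occurrence, which is
    how Wick's formula counts pairings. *)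
Fixpoint dels (s : seq K) : seq (K * seq K) :=
  if s is x :: s' then (x, s') :: [seq (z.1, x :: z.2) | z <- dels s'] else [::].

Arguments dels : simpl never.

Lemma size_dels s : size (dels s) = size s.
Proof. by elim: s => //= x s IH; rewrite /dels /= size_map IH. Qed.

Lemma dels_perm s z : z \in dels s -> perm_eq s (z.1 :: z.2).
Proof.
elim: s z => // x s IH z; rewrite inE => /orP[/eqP ->//|/mapP[u uin ->]] /=.
have := IH _ uin; rewrite -(perm_cons x) => h.
apply: (perm_trans h); apply/permP => a /=; lia.
Qed.

Variable V : nmodType.

Lemma big_dels_cons (F : K * seq K -> V) x s :
  \sum_(z <- dels (x :: s)) F z =
  F (x, s) + \sum_(z <- dels s) F (z.1, x :: z.2).
Proof. by rewrite /dels /= big_cons big_map. Qed.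

(** Both sides run over ordered pairs of distinct positions; the two orders of removal leave the
    same remainder. *)
Lemma dels_swap (f : K -> K -> seq K -> V) s :
  \sum_(z <- dels s) \sum_(u <- dels z.2) f z.1 u.1 u.2 =
  \sum_(z <- dels s) \sum_(u <- dels z.2) f u.1 z.1 u.2.
Proof.
elim: s f => [|x s IH] f; first by rewrite !big_nil.
rewrite !big_dels_cons /=.
have E (g : K -> K -> seq K -> V) :
    \sum_(z <- dels s) \sum_(u <- dels (x :: z.2)) g z.1 u.1 u.2 =
    \sum_(z <- dels s) g z.1 x z.2 +
    \sum_(z <- dels s) \sum_(u <- dels z.2) g z.1 u.1 (x :: u.2).
  by rewrite -big_split; apply: eq_bigr => z _; rewrite big_dels_cons.
by rewrite (E f) (E (fun a b c => f b a c)) (IH (fun a b c => f a b (x :: c))) addrCA.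
Qed.

Lemma sum_tupleS k (F : seq K -> V) :
  \sum_(t : k.+1.-tuple K) F t = \sum_(x : K) \sum_(t : k.-tuple K) F (x :: t).
Proof.
rewrite pair_big /=.
rewrite (reindex (fun z : K * k.-tuple K => [tuple of z.1 :: z.2])) //=.
exists (fun t => (thead t, [tuple of behead t])).
- move=> [x t] _ /=; congr (_, _); apply/val_inj; by case: t => [[|a t] i].
- by move=> t _ /=; rewrite [RHS]tuple_eta.
Qed.

Lemma sum_tuple0 (F : seq K -> V) : \sum_(t : 0.-tuple K) F t = F [::].
Proof.
by rewrite (big_pred1 [tuple]) // => t; rewrite /= (tuple0 t); apply/esym/eqP.
Qed.

(** A removal is undone by inserting [o] at one of [k.+1] positions, so each pair [(o, t)] is
    reached [k.+1] times. *)
Lemma sum_tuple_dels k (F : K -> seq K -> V) :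
  \sum_(t : k.+1.-tuple K) \sum_(z <- dels t) F z.1 z.2 =
  (\sum_(o : K) \sum_(t : k.-tuple K) F o t) *+ k.+1.
Proof.
elim: k F => [|k IH] F.
  rewrite (sum_tupleS _ (fun t => \sum_(z <- dels t) F z.1 z.2)).
  apply: eq_bigr => x _.
  rewrite (sum_tuple0 (fun t => \sum_(z <- dels (x :: t)) F z.1 z.2)).
  by rewrite big_dels_cons big_nil addr0 (sum_tuple0 (F x)).
rewrite (sum_tupleS _ (fun t => \sum_(z <- dels t) F z.1 z.2)).
under eq_bigr do under eq_bigr do rewrite big_dels_cons /=.
under eq_bigr do rewrite big_split /= (IH (fun o t => F o (_ :: t))).
rewrite big_split /= [RHS]mulrS; congr (_ + _).
rewrite sumrMnl; congr (_ *+ _); rewrite exchange_big /=; apply: eq_bigr => o _.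
by rewrite (sum_tupleS _ (F o)).
Qed.

(** [catrev A B] is [rev A ++ B], and reversal permutes the tuples; passed-over letters return to
    the stack in this order. *)
Lemma sum_tuple_catrev a b (F : seq K -> V) :
  \sum_(A : a.-tuple K) \sum_(B : b.-tuple K) F (catrev A B) =
  \sum_(t : (a + b).-tuple K) F t.
Proof.
elim: a b F => [|a IH] b F.
  by rewrite (sum_tuple0 (fun A => \sum_(B : b.-tuple K) F (catrev A B))).
rewrite (sum_tupleS _ (fun A => \sum_(B : b.-tuple K) F (catrev A B))).
rewrite exchange_big /=.
transitivity (\sum_(A : a.-tuple K) \sum_(B : b.+1.-tuple K) F (catrev A B)).
  by apply: eq_bigr => A _; rewrite (sum_tupleS _ (fun B => F (catrev A B))).
by rewrite IH addSnnS.
Qed.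
End Dels.

(** * Cauchy-Schwarz inequalities and squared norms *)

Section CS.
Variable C : numClosedFieldType.

Lemma normr2_add (x y : C) : `|x + y| ^+ 2 <= (`|x| ^+ 2 + `|y| ^+ 2) *+ 2.
Proof.
apply: (@le_trans _ _ ((`|x| + `|y|) ^+ 2)).
  by rewrite ler_pXn2r ?nnegrE ?addr_ge0 // ler_normD.
rewrite -subr_ge0.
have -> : (`|x| ^+ 2 + `|y| ^+ 2) *+ 2 - (`|x| + `|y|) ^+ 2 = (`|x| - `|y|) ^+ 2.
  by ring.
by apply: real_exprn_even_ge0 => //; rewrite realB.
Qed.

(** Lagrange's identity: twice the defect is the sum of the squared 2x2 minors, which are
    nonnegative because everything is real. *)
Lemma real_cauchy (I : finType) (a b : I -> C) :
  (forall i, a i \is Num.real) -> (forall i, b i \is Num.real) ->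
  (\sum_i a i * b i) ^+ 2 <= (\sum_i a i ^+ 2) * (\sum_i b i ^+ 2).
Proof.
move=> ra rb; rewrite -subr_ge0.
suff : 0 <= ((\sum_i a i ^+ 2) * (\sum_i b i ^+ 2) - (\sum_i a i * b i) ^+ 2) *+ 2.
  by rewrite pmulrn_lge0.
have -> : ((\sum_i a i ^+ 2) * (\sum_i b i ^+ 2) - (\sum_i a i * b i) ^+ 2) *+ 2 =
   \sum_i \sum_j (a i * b j - a j * b i) ^+ 2.
  transitivity ((\sum_i \sum_j (a i ^+ 2 * b j ^+ 2)) +
     (\sum_i \sum_j (a j ^+ 2 * b i ^+ 2)) -
     (\sum_i \sum_j (a i * b i * (a j * b j))) *+ 2).
    rewrite [X in _ + X - _]exchange_big /=.
    have -> : \sum_i \sum_j (a i ^+ 2 * b j ^+ 2) =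
      (\sum_i a i ^+ 2) * (\sum_i b i ^+ 2).
      by rewrite mulr_suml; apply: eq_bigr => i _; rewrite mulr_sumr.
    have -> : \sum_i \sum_j (a i * b i * (a j * b j)) = (\sum_i a i * b i) ^+ 2.
      by rewrite expr2 mulr_suml; apply: eq_bigr => i _; rewrite mulr_sumr.
    by rewrite mulrnBl mulr2n.
  rewrite -sumrMnl -big_split -sumrB /=; apply: eq_bigr => i _.
  rewrite -sumrMnl -big_split -sumrB /=; apply: eq_bigr => j _.
  by ring.
apply: sumr_ge0 => i _; apply: sumr_ge0 => j _.
by apply: real_exprn_even_ge0 => //; rewrite realB ?realM.
Qed.

Lemma cauchy_schwarz (I : finType) (x y : I -> C) :
  `|\sum_i x i * y i| ^+ 2 <= (\sum_i `|x i| ^+ 2) * (\sum_i `|y i| ^+ 2).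
Proof.
apply: le_trans (real_cauchy (fun i => normr_real (x i)) (fun i => normr_real (y i))).
have h : `|\sum_i x i * y i| <= \sum_i `|x i| * `|y i|.
  by apply: le_trans (ler_norm_sum _ _ _) _; apply: ler_sum => i _; rewrite normrM.
rewrite lerXn2r // nnegrE; apply: sumr_ge0 => i _; exact: mulr_ge0.
Qed.

Lemma normr_sum2 (I : finType) (x : I -> C) :
  `|\sum_i x i| ^+ 2 <= #|I|%:R * \sum_i `|x i| ^+ 2.
Proof.
have := cauchy_schwarz (fun=> 1) x; under eq_bigr do rewrite mul1r.
by under [X in X * _]eq_bigr do rewrite normr1 expr1n; rewrite sumr_const.
Qed.

Lemma normr_seq_sum2 (I : eqType) (r : seq I) (x : I -> C) :
  `|\sum_(i <- r) x i| ^+ 2 <= (size r)%:R * \sum_(i <- r) `|x i| ^+ 2.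
Proof.
case: r => [|i0 r']; first by rewrite !big_nil normr0 expr0n mul0r.
rewrite (big_nth i0) big_mkord.
by rewrite [X in _ <= _ * X](big_nth i0) big_mkord -[X in X%:R]card_ord normr_sum2.
Qed.
End CS.

Section Dot.
Variable C : numClosedFieldType.

(** Squared norms are used throughout, so that the estimates stay inside [C] and need no square
    root. *)
Definition nrm2 r c (v : 'M[C]_(r, c)) : C := \sum_i \sum_j `|v i j| ^+ 2.
(** Bilinear, with no conjugate, so that [act N] is moved to the other side as the plain transpose
    [lact]. *)
Definition dot r c (u v : 'M[C]_(r, c)) : C := \sum_i \sum_j u i j * v i j.

Lemma nrm2_ge0 r c (v : 'M[C]_(r, c)) : 0 <= nrm2 v.
Proof. by do 2![apply: sumr_ge0 => ? _]; exact: exprn_ge0. Qed.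
Hint Resolve nrm2_ge0 : core.

Lemma dotC r c (u v : 'M[C]_(r, c)) : dot u v = dot v u.
Proof. by apply: eq_bigr => i _; apply: eq_bigr => j _; rewrite mulrC. Qed.

Lemma dot0r r c (u : 'M[C]_(r, c)) : dot u 0 = 0.
Proof. by rewrite /dot big1 // => i _; rewrite big1 // => j _; rewrite mxE mulr0. Qed.

Lemma dotDr r c (u v w : 'M[C]_(r, c)) : dot u (v + w) = dot u v + dot u w.
Proof.
rewrite -big_split; apply: eq_bigr => i _; rewrite -big_split.
by apply: eq_bigr => j _; rewrite mxE mulrDr.
Qed.

Lemma dot_sumr r c (I : Type) (s : seq I) P (F : I -> 'M[C]_(r, c)) u :
  dot u (\sum_(i <- s | P i) F i) = \sum_(i <- s | P i) dot u (F i).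
Proof. by apply: (big_morph _ (dotDr u) (dot0r u)). Qed.

Lemma nrm20 r c : nrm2 (0 : 'M[C]_(r, c)) = 0.
Proof.
by rewrite /nrm2 big1 // => i _; rewrite big1 // => j _; rewrite mxE normr0 expr0n.
Qed.

Lemma nrm2Z r c z (v : 'M[C]_(r, c)) : nrm2 (z *: v) = `|z| ^+ 2 * nrm2 v.
Proof.
rewrite mulr_sumr; apply: eq_bigr => i _; rewrite mulr_sumr.
by apply: eq_bigr => j _; rewrite mxE normrM exprMn.
Qed.

Lemma nrm2_tr r c (v : 'M[C]_(r, c)) : nrm2 v^T = nrm2 v.
Proof.
rewrite /nrm2 exchange_big; apply: eq_bigr => i _; apply: eq_bigr => j _.
by rewrite mxE.
Qed.

Lemma nrm2_cV r (v : 'cV[C]_r) : nrm2 v = \sum_i `|v i 0| ^+ 2.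
Proof. by apply: eq_bigr => i _; rewrite big_ord1. Qed.

Lemma nrm2_col r c (v : 'M[C]_(r, c)) : nrm2 v = \sum_j nrm2 (col j v).
Proof.
rewrite /nrm2 exchange_big; apply: eq_bigr => j _; apply: eq_bigr => i _.
by rewrite big_ord1 mxE.
Qed.

Lemma dot_cs_sum (I : finType) r c (u v : I -> 'M[C]_(r, c)) :
  `|\sum_i dot (u i) (v i)| ^+ 2 <= (\sum_i nrm2 (u i)) * (\sum_i nrm2 (v i)).
Proof.
have E (f : I -> 'I_r -> 'I_c -> C) : \sum_i \sum_j \sum_k f i j k =
    \sum_(z : I * ('I_r * 'I_c)) f z.1 z.2.1 z.2.2.
  rewrite -(pair_bigA _ (fun i z => f i z.1 z.2)) /=; apply: eq_bigr => i _.
  by rewrite pair_bigA.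
by rewrite /dot /nrm2 !E; exact: cauchy_schwarz.
Qed.

Lemma dot_cs r c (u v : 'M[C]_(r, c)) : `|dot u v| ^+ 2 <= nrm2 u * nrm2 v.
Proof. by have := dot_cs_sum (fun _ : 'I_1 => u) (fun=> v); rewrite !big_ord1. Qed.

(** Testing against the entrywise conjugate of [w] turns the hypothesis into
    [nrm2 w ^+ 2 <= nrm2 w * B]. *)
Lemma nrm2_dual r c (w : 'M[C]_(r, c)) B : 0 <= B ->
  (forall u, `|dot u w| ^+ 2 <= nrm2 u * B) -> nrm2 w <= B.
Proof.
move=> B0 /(_ (map_mx Num.conj w)).
have -> : dot (map_mx Num.conj w) w = nrm2 w.
  by apply: eq_bigr => i _; apply: eq_bigr => j _; rewrite mxE normCKC.
have -> : nrm2 (map_mx Num.conj w) = nrm2 w.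
  by apply: eq_bigr => i _; apply: eq_bigr => j _; rewrite mxE norm_conjC.
rewrite ger0_norm //; have [->//|w0] := eqVneq (nrm2 w) 0.
by rewrite expr2 ler_pM2l // lt_def w0 nrm2_ge0.
Qed.

Lemma nrm2_sum_seq r c (I : eqType) (s : seq I) (F : I -> 'M[C]_(r, c)) :
  nrm2 (\sum_(i <- s) F i) <= (size s)%:R * \sum_(i <- s) nrm2 (F i).
Proof.
have -> : (size s)%:R * \sum_(i <- s) nrm2 (F i) =
    \sum_j \sum_k (size s)%:R * \sum_(i <- s) `|F i j k| ^+ 2.
  under [RHS]eq_bigr do rewrite -mulr_sumr.
  rewrite -mulr_sumr; congr (_ * _).
  rewrite exchange_big; apply: eq_bigr => j _ /=; by rewrite exchange_big.
apply: ler_sum => j _; apply: ler_sum => k _.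
by rewrite summxE; exact: normr_seq_sum2.
Qed.

Lemma nrm2_add_seq r c (I : eqType) (s : seq I) (F : I -> 'M[C]_(r, c)) v :
  nrm2 (v + \sum_(i <- s) F i) <=
  (size s).+1%:R * (nrm2 v + \sum_(i <- s) nrm2 (F i)).
Proof.
have := nrm2_sum_seq (None :: map Some s) (fun o => if o is Some i then F i else v).
by rewrite !big_cons !big_map /= size_map.
Qed.
End Dot.
#[global] Hint Resolve nrm2_ge0 : core.

(** * Contractions of C^p (x) C^n and their partial traces *)

Section Blocks.
Variables (C : numClosedFieldType) (n p : nat).
Local Notation M := 'M['M[C]_n]_p.

Definition ptr (N : M) : 'M[C]_p := \matrix_(k, l) (n%:R^-1 * \tr (N k l)).
Definition scal (Y : 'M[C]_p) : M := map_mx scalar_mx Y.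

(** A vector of C^p (x) C^n is kept as a p x n matrix, so that [scal Y] multiplies it on the left
    and [e%:M] on the right. *)
Definition act (N : M) (v : 'M[C]_(p, n)) : 'M[C]_(p, n) :=
  \matrix_(k, a) \sum_l \sum_b N k l a b * v l b.
Definition lact (v : 'M[C]_(p, n)) (N : M) : 'M[C]_(p, n) :=
  \matrix_(l, b) \sum_k \sum_a v k a * N k l a b.

Lemma act_mul N P v : act (N *m P) v = act N (act P v).
Proof.
apply/matrixP => k a; rewrite !mxE.
under eq_bigr do under eq_bigr do rewrite mxE summxE mulr_suml.
under [RHS]eq_bigr do under eq_bigr do rewrite mxE mulr_sumr.
under eq_bigr do rewrite exchange_big.
rewrite exchange_big /=; apply: eq_bigr => q _.
under [RHS]eq_bigr do under eq_bigr do rewrite mulr_sumr.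
rewrite [RHS]exchange_big /=; apply: eq_bigr => l _.
rewrite [RHS]exchange_big /=; apply: eq_bigr => b _.
rewrite mxE mulr_suml; apply: eq_bigr => c _.
by rewrite mulrA.
Qed.

Lemma lact_mul v N P : lact v (N *m P) = lact (lact v N) P.
Proof.
apply/matrixP => l b; rewrite !mxE.
under eq_bigr do under eq_bigr do rewrite mxE summxE mulr_sumr.
under [RHS]eq_bigr do under eq_bigr do rewrite mxE mulr_suml.
under eq_bigr do rewrite exchange_big.
rewrite exchange_big /=; apply: eq_bigr => q _.
under [RHS]eq_bigr do under eq_bigr do rewrite mulr_suml.
rewrite [RHS]exchange_big /=; apply: eq_bigr => k _.
rewrite [RHS]exchange_big /=; apply: eq_bigr => a _.
rewrite mxE mulr_sumr; apply: eq_bigr => c _.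
by rewrite mulrA.
Qed.

Lemma dot_act u N v : dot u (act N v) = dot (lact u N) v.
Proof.
rewrite /dot; under eq_bigr do under eq_bigr do rewrite mxE mulr_sumr.
under [RHS]eq_bigr do under eq_bigr do rewrite mxE mulr_suml.
under eq_bigr do rewrite exchange_big.
rewrite exchange_big /=; apply: eq_bigr => l _.
under eq_bigr do under eq_bigr do rewrite mulr_sumr.
under [RHS]eq_bigr do under eq_bigr do rewrite mulr_suml.
under eq_bigr do rewrite exchange_big.
rewrite exchange_big /=; apply: eq_bigr => b _; apply: eq_bigr => k _.
by apply: eq_bigr => a _; rewrite mulrA.
Qed.

Lemma actDl N P v : act (N + P) v = act N v + act P v.
Proof.
apply/matrixP => k a; rewrite !mxE -big_split; apply: eq_bigr => l _.
by rewrite -big_split; apply: eq_bigr => b _; rewrite !mxE mulrDl.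
Qed.

Lemma act0l v : act 0 v = 0.
Proof.
apply/matrixP => k a; rewrite !mxE big1 // => l _; rewrite big1 // => b _.
by rewrite !mxE mul0r.
Qed.

Lemma act_suml (I : Type) (s : seq I) P (F : I -> M) v :
  act (\sum_(i <- s | P i) F i) v = \sum_(i <- s | P i) act (F i) v.
Proof. by apply: (big_morph (fun N => act N v) (fun N P => actDl N P v) (act0l v)). Qed.

Lemma act_scalar (e : 'M[C]_n) v : act e%:M v = v *m e^T.
Proof.
apply/matrixP => k a; rewrite !mxE (bigD1 k) //= [X in _ + X]big1 ?addr0 => [|l lk].
  by apply: eq_bigr => b _; rewrite !mxE eqxx mulr1n mulrC.
by rewrite big1 // => b _; rewrite !mxE eq_sym (negbTE lk) mulr0n mxE mul0r.
Qed.

Lemma lact_scalar (e : 'M[C]_n) v : lact v e%:M = v *m e.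
Proof.
apply/matrixP => k a; rewrite !mxE (bigD1 k) //= [X in _ + X]big1 ?addr0 => [|l lk].
  by apply: eq_bigr => b _; rewrite !mxE eqxx mulr1n.
by rewrite big1 // => b _; rewrite !mxE (negbTE lk) mulr0n mxE mulr0.
Qed.

Lemma act_scal Y v : act (scal Y) v = Y *m v.
Proof.
apply/matrixP => k a; rewrite !mxE; apply: eq_bigr => l _.
rewrite (bigD1 a) //= [X in _ + X]big1 ?addr0 => [|b ba].
  by rewrite !mxE eqxx mulr1n.
by rewrite !mxE eq_sym (negbTE ba) mulr0n mul0r.
Qed.

Lemma lact_scal Y v : lact v (scal Y) = Y^T *m v.
Proof.
apply/matrixP => k a; rewrite !mxE; apply: eq_bigr => l _.
rewrite (bigD1 a) //= [X in _ + X]big1 ?addr0 => [|b ba].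
  by rewrite !mxE eqxx mulr1n mulrC.
by rewrite !mxE (negbTE ba) mulr0n mulr0.
Qed.

(** Norm at most 1, phrased through the bilinear form so that it passes to [act] and to [lact]
    alike. *)
Definition ctr (N : M) : Prop :=
  forall u v, `|dot u (act N v)| ^+ 2 <= nrm2 u * nrm2 v.

Lemma ctr_act N v : ctr N -> nrm2 (act N v) <= nrm2 v.
Proof. by move=> cN; apply: nrm2_dual => // u; exact: cN. Qed.

Lemma ctr_lact N v : ctr N -> nrm2 (lact v N) <= nrm2 v.
Proof.
by move=> cN; apply: nrm2_dual => // u; rewrite dotC -dot_act [leRHS]mulrC; exact: cN.
Qed.

Lemma actP_ctr N : (forall v, nrm2 (act N v) <= nrm2 v) -> ctr N.
Proof.
move=> h u v; apply: le_trans (dot_cs _ _) _; exact: (ler_wpM2l (nrm2_ge0 _) (h _)).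
Qed.

Lemma ctr_mul N P : ctr N -> ctr P -> ctr (N *m P).
Proof.
move=> cN cP; apply: actP_ctr => v; rewrite act_mul.
exact: le_trans (ctr_act _ cN) (ctr_act _ cP).
Qed.

Lemma ctr1 : ctr 1%:M.
Proof. by apply: actP_ctr => v; rewrite act_scalar trmx1 mulmx1. Qed.

Definition tens (x : 'cV[C]_p) (s : 'I_n) : 'M[C]_(p, n) := x *m delta_mx 0 s.

Lemma tensE x s k a : tens x s k a = x k 0 * (a == s)%:R.
Proof. by rewrite !mxE big_ord1 !mxE eqxx. Qed.

Lemma nrm2_tens x s : nrm2 (tens x s) = nrm2 x.
Proof.
rewrite nrm2_cV; apply: eq_bigr => k _.
rewrite (bigD1 s) //= [X in _ + X]big1 ?addr0 => [|a as_]; rewrite tensE.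
  by rewrite eqxx mulr1.
by rewrite (negbTE as_) mulr0 normr0 expr0n.
Qed.

(* The bilinear form of the partial trace is an average of the diagonal blocks
   seen by the vectors [x (x) e_s]. *)
Lemma dot_ptr (x y : 'cV[C]_p) N :
  dot x (ptr N *m y) = n%:R^-1 * \sum_s dot (tens x s) (act N (tens y s)).
Proof.
transitivity (n%:R^-1 * \sum_k \sum_l \sum_s x k 0 * N k l s s * y l 0).
  rewrite mulr_sumr; apply: eq_bigr => k _; rewrite big_ord1 mxE mulr_sumr mulr_sumr.
  apply: eq_bigr => l _; rewrite mxE /mxtrace mulr_sumr mulr_suml !mulr_sumr.
  by apply: eq_bigr => s _; ring.
congr (_ * _); rewrite [RHS]exchange_big; apply: eq_bigr => k _.
rewrite exchange_big; apply: eq_bigr => s _ /=.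
rewrite (bigD1 s) //= [X in _ + X]big1 ?addr0 => [|a as_]; rewrite tensE ?eqxx.
  rewrite mulr1 mxE mulr_sumr; apply: eq_bigr => l _.
  rewrite (bigD1 s) //= [X in _ + X]big1 ?addr0 => [|b bs]; rewrite tensE.
    by rewrite eqxx mulr1 mulrA.
  by rewrite (negbTE bs) !mulr0.
by rewrite (negbTE as_) mulr0 mul0r.
Qed.

Hypothesis n_gt0 : (0 < n)%N.

(** [scal] acts on the columns of [v] one by one, and there [dot_ptr] is an average of [n] numbers
    of squared modulus at most [nrm2 x * nrm2 y]. *)
Lemma ctr_ptr N : ctr N -> ctr (scal (ptr N)).
Proof.
move=> cN; apply: actP_ctr => v; rewrite act_scal nrm2_col [leRHS]nrm2_col.
apply: ler_sum => j _; rewrite [col j (_ *m _)]colE -mulmxA -colE.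
set y := col j v; apply: nrm2_dual => [|x]; first exact: nrm2_ge0.
rewrite dot_ptr normrM exprMn.
have n0 : (n%:R : C) != 0 by rewrite pnatr_eq0 -lt0n.
apply: (@le_trans _ _ (`|n%:R^-1| ^+ 2 * (n%:R * (\sum_(s < n) nrm2 x * nrm2 y)))).
  rewrite ler_wpM2l ?exprn_ge0 //.
  apply: le_trans (normr_sum2 _) _; rewrite card_ord ler_wpM2l ?ler0n //.
  by apply: ler_sum => s _; rewrite -(nrm2_tens x s) -(nrm2_tens y s); exact: cN.
rewrite sumr_const card_ord -mulr_natl ger0_norm ?invr_ge0 ?ler0n //.
rewrite le_eqVlt; apply/orP; left; apply/eqP; field; exact: n0.
Qed.

(** A block is a compression: feed a vector supported in row [l] and keep only row [k] of the
    result. *)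
Lemma block_le N k l (x : 'cV[C]_n) : ctr N -> nrm2 (N k l *m x) <= nrm2 x.
Proof.
move=> cN; have := ctr_act (delta_mx l 0 *m x^T) cN.
have -> : nrm2 (delta_mx l 0 *m x^T : 'M[C]_(p, n)) = nrm2 x.
  rewrite -[RHS]nrm2_tr /nrm2 (bigD1 l) //= [X in _ + X]big1 ?addr0 => [|i il].
    by rewrite big_ord1; apply: eq_bigr => j _; rewrite mxE big_ord1 !mxE !eqxx mul1r.
  by apply: big1 => j _; rewrite mxE big_ord1 mxE (negbTE il) mul0r normr0 expr0n.
apply: le_trans.
rewrite {2}/nrm2 (bigD1 k) //= -[leLHS]addr0 lerD //; last first.
  by do 2![apply: sumr_ge0 => ? _]; exact: exprn_ge0.
rewrite nrm2_cV; apply: ler_sum => a _.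
rewrite le_eqVlt; apply/orP; left; apply/eqP; congr (`|_| ^+ 2).
rewrite !mxE (bigD1 l) //= [X in _ + X]big1 ?addr0 => [|i il].
  by apply: eq_bigr => b _; rewrite mxE big_ord1 !mxE !eqxx mul1r.
by rewrite big1 // => b _; rewrite mxE big_ord1 mxE (negbTE il) mul0r mulr0.
Qed.

End Blocks.
Arguments scal {C n p} Y.

(** * The Wick recursion *)

Section Letters.
Variables (C : numClosedFieldType) (n p : nat).
Local Notation M := 'M['M[C]_n]_p.
Local Notation letter := ('I_n * 'I_n * bool)%type.

(** Coefficient of the real ([t = true]) or imaginary part in z ([e = true]) or in its conjugate. *)
Definition kap (e t : bool) : C := if t then 1 else if e then 'i else - 'i.

(* [X = \sum_o Y_o *: unitE true o] and [X^* = \sum_o Y_o *: unitE false o], where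
   [Y] lists the real and imaginary parts of the entries of [X]. *)
Definition unitE (e : bool) (o : letter) : 'M[C]_n :=
  kap e o.2 *: (if e then delta_mx o.1.1 o.1.2 else delta_mx o.1.2 o.1.1).

Definition two_n : C := (2 * n)%:R.
(** The variance of the real and of the imaginary part of an entry. *)
Definition var_n : C := two_n^-1.

Lemma tn_ge0 : 0 <= two_n. Proof. exact: ler0n. Qed.
Lemma s2_ge0 : 0 <= var_n. Proof. by rewrite invr_ge0 tn_ge0. Qed.
Hint Resolve tn_ge0 s2_ge0 : core.

Lemma norm_kap e t : `|kap e t| ^+ 2 = 1.
Proof.
by case: t e => [] [] /=; rewrite ?normrN ?normCi ?normr1 expr1n.
Qed.

(** The vanishing case is E[z^2] = 0: a letter pairs only with its adjoint. *)
Lemma sum_kap e e' : \sum_t kap e t * kap e' t = if e == e' then 0 else 2.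
Proof.
rewrite big_bool /=; case: e e' => [] [] /=;
 rewrite ?mulrNN ?mulNr ?mulrN -?expr2 ?sqrCi ?mulr1; ring.
Qed.

Lemma sum_letter (V : nmodType) (F : letter -> V) :
  \sum_o F o = \sum_a \sum_b \sum_t F (a, b, t).
Proof.
by rewrite pair_bigA pair_bigA /=; apply: eq_bigr => -[[a b] t].
Qed.

(** Each column of [v] is reproduced by [n] matrix units with two components each; the 2n is the
    cost of an open letter. *)
Lemma sum_unitE e (v : 'M[C]_(p, n)) : \sum_o nrm2 (v *m unitE e o) = two_n * nrm2 v.
Proof.
have D a b : nrm2 (v *m delta_mx a b) = \sum_k `|v k a| ^+ 2.
  apply: eq_bigr => k _; rewrite (bigD1 b) //= [X in _ + X]big1 ?addr0 => [|c cb].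
    rewrite mxE (bigD1 a) //= [X in _ + X]big1 ?addr0 => [|c ca].
      by rewrite mxE !eqxx mulr1.
    by rewrite mxE (negbTE ca) mulr0.
  rewrite mxE big1 ?normr0 ?expr0n // => d _.
  by rewrite mxE (negbTE cb) andbF mulr0.
rewrite sum_letter.
under eq_bigr do under eq_bigr do under eq_bigr do
  rewrite -scalemxAr nrm2Z norm_kap mul1r /=.
have -> : two_n * nrm2 v = \sum_(a < n) \sum_(b < n) \sum_(t : bool) \sum_k `|v k a| ^+ 2.
  rewrite /nrm2 exchange_big mulr_sumr; apply: eq_bigr => a _.
  by rewrite !sumr_const card_ord card_bool -mulrnA mulr_natl mulnC.
case: e; last rewrite exchange_big /=; apply: eq_bigr => a _; apply: eq_bigr => b _;
  by apply: eq_bigr => t _; rewrite D.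
Qed.

(** Dual of [sum_unitE]: once the letters are moved to the test vector, Cauchy-Schwarz in the letter
    index suffices. *)
Lemma push_le e (g : letter -> 'M[C]_(p, n)) :
  nrm2 (\sum_o act (unitE e o)%:M (g o)) <= two_n * \sum_o nrm2 (g o).
Proof.
apply: nrm2_dual => [|u]; first by apply: mulr_ge0 => //; apply: sumr_ge0 => o _; exact: nrm2_ge0.
rewrite dot_sumr; under eq_bigr do rewrite dot_act.
apply: le_trans (dot_cs_sum _ _) _; under eq_bigr do rewrite lact_scalar.
by rewrite sum_unitE mulrCA mulrA.
Qed.

Lemma sum_act_unitE e (v : 'M[C]_(p, n)) :
  \sum_o nrm2 (act (unitE e o)%:M v) = two_n * nrm2 v.
Proof.
rewrite -(sum_unitE (~~ e)); apply: eq_bigr => o _; rewrite act_scalar.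
rewrite /unitE linearZ /= -!scalemxAr !nrm2Z !norm_kap.
by case: e; rewrite /= trmx_delta.
Qed.

Lemma sum_lact_unitE e (v : 'M[C]_(p, n)) :
  \sum_o nrm2 (lact v (unitE e o)%:M) = two_n * nrm2 v.
Proof. by under eq_bigr do rewrite lact_scalar; exact: sum_unitE. Qed.

Hypothesis n_gt0 : (0 < n)%N.

Lemma tn_neq0 : two_n != 0.
Proof. by rewrite pnatr_eq0 muln_eq0 /= -lt0n. Qed.

(** The products E_ab A E_ba sum to the trace of [A], doubled by the two components; for equal types
    the components cancel. *)
Lemma tr_unitE e e' (A : 'M[C]_n) :
  \sum_o unitE e o *m A *m unitE e' o =
  (if e == e' then 0 else 2 * \tr A)%:M.
Proof.
have D a b c d (B : 'M[C]_n) :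
    delta_mx a b *m B *m delta_mx c d = B b c *: delta_mx a d :> 'M[C]_n.
  apply/matrixP => x y; rewrite !mxE (bigD1 c) //= [X in _ + X]big1 ?addr0.
    rewrite !mxE (bigD1 b) //= [X in _ + X]big1 ?addr0.
      by rewrite !mxE !eqxx andbT; case: (x == a); case: (y == d) => /=; ring.
    by move=> z zb; rewrite !mxE (negbTE zb) andbF mul0r.
  by move=> z zc; rewrite !mxE (negbTE zc) mulr0.
rewrite sum_letter /=.
have S (F : 'I_n -> 'I_n -> 'M[C]_n) :
    \sum_a \sum_b \sum_t (kap e t * kap e' t) *: F a b =
    (if e == e' then 0 else 2) *: \sum_a \sum_b F a b.
  rewrite scaler_sumr; apply: eq_bigr => a _; rewrite scaler_sumr.
  by apply: eq_bigr => b _; rewrite -scaler_suml sum_kap.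
have T : \sum_a delta_mx a a = 1%:M :> 'M[C]_n by rewrite mx1_sum_delta.
have [ee|ee] := eqVneq e e'.
  rewrite raddf0 -[RHS](scale0r (\sum_a \sum_b
     (if e then delta_mx a b else delta_mx b a) *m A *m
     (if e' then delta_mx a b else delta_mx b a))).
  have := S (fun a b => (if e then delta_mx a b else delta_mx b a) *m A *m
     (if e' then delta_mx a b else delta_mx b a)).
  rewrite ee eqxx => <-; apply: eq_bigr => a _; apply: eq_bigr => b _.
  by apply: eq_bigr => t _; rewrite /unitE -!scalemxAl -!scalemxAr scalerA.
transitivity (2 *: \sum_a \sum_b ((if e then delta_mx a b else delta_mx b a) *m A *m
     (if e' then delta_mx a b else delta_mx b a))).
  have := S (fun a b => (if e then delta_mx a b else delta_mx b a) *m A *m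
     (if e' then delta_mx a b else delta_mx b a)).
  rewrite (negbTE ee) => <-; apply: eq_bigr => a _; apply: eq_bigr => b _.
  by apply: eq_bigr => t _; rewrite /unitE -!scalemxAl -!scalemxAr scalerA.
rewrite -[_%:M]scalemx1 -T -scalerA; congr (_ *: _).
rewrite scaler_sumr; case: e e' ee {S} => [] [] // _; last rewrite exchange_big;
  apply: eq_bigr => a _; under eq_bigr do rewrite D; by rewrite -scaler_suml.
Qed.

Lemma scalar_mulE (e : 'M[C]_n) (N : M) k l : (e%:M *m N) k l = e *m N k l.
Proof.
rewrite mxE (bigD1 k) //= [X in _ + X]big1 ?addr0 => [|j jk]; first by rewrite mxE eqxx.
by rewrite mxE eq_sym (negbTE jk) mulr0n mul0r.
Qed.

Lemma mul_scalarE (e : 'M[C]_n) (N : M) k l : (N *m e%:M) k l = N k l *m e.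
Proof.
rewrite mxE (bigD1 l) //= [X in _ + X]big1 ?addr0 => [|j jk]; first by rewrite mxE eqxx.
by rewrite mxE (negbTE jk) mulr0n mulr0.
Qed.

(** [var_n] times the 2 of [tr_unitE] is 1/n, which normalizes the trace of each block. *)
Lemma planar e e' (N : M) :
  \sum_o (unitE e o)%:M *m N *m (var_n *: unitE e' o)%:M =
  if e == e' then 0 else scal (ptr N).
Proof.
have n0 : (n%:R : C) != 0 by rewrite pnatr_eq0 -lt0n.
apply/matrixP => k l; rewrite summxE.
transitivity (var_n *: \sum_o unitE e o *m N k l *m unitE e' o).
  rewrite scaler_sumr; apply: eq_bigr => o _.
  by rewrite mul_scalarE scalar_mulE -!scalemxAr.
rewrite tr_unitE; case: eqP => _; rewrite ?raddf0 ?scaler0 !mxE //.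
rewrite scale_scalar_mx; congr (_%:M).
rewrite /var_n /two_n natrM invfM; field.
exact: n0.
Qed.


(* [Cc s O] is the expectation of the random word [s], differentiated in the
   directions [O]: every letter of [O] is paired with a letter of [s]. *)
Fixpoint Cc (s : seq (bool * M)) (O : seq letter) : M :=
  if s is (e, N) :: s' then
    \sum_o (unitE e o)%:M *m N *m Cc s' (o :: O) +
    \sum_(z <- dels O) (var_n *: unitE e z.1)%:M *m N *m Cc s' z.2
  else if O is [::] then 1%:M else 0.

(** [k.+1] counts the terms met by [nrm2_add_seq] (open, or close one of [k]); the inner [k] is the
    multiplicity in [sum_tuple_dels]. *)
Fixpoint cB (r k : nat) : nat :=
  if r is r'.+1 then (k.+1 * (cB r' k.+1 + k * cB r' k.-1))%N else 1%N.

(** Each letter preserves the weight [var_n ^+ k]: opening costs 2n but leaves [k.+1] letters to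
    close, and closing costs [var_n ^+ 2] times the 2n of [sum_act_unitE], that is [var_n]. *)
Lemma Cc_bound s k v : (forall x, x \in s -> ctr x.2) ->
  \sum_(O : k.-tuple letter) nrm2 (act (Cc s O) v) <=
  (cB (size s) k)%:R * var_n ^+ k * nrm2 v.
Proof.
elim: s k => [|[e N] s IH] k cs.
  case: k => [|k]; last first.
    rewrite big1 => [|O _]; last by case: O => [[|o O] i] //=; rewrite act0l nrm20.
    by rewrite !mulr_ge0 ?exprn_ge0 ?ler0n ?nrm2_ge0.
  rewrite (sum_tuple0 (fun O => nrm2 (act (Cc [::] O) v))) /=.
  by rewrite act_scalar trmx1 mulmx1 expr0 !mul1r.
have cN : ctr N by apply: (cs (e, N)); rewrite inE eqxx.
have {}IH j : \sum_(O : j.-tuple letter) nrm2 (act N (act (Cc s O) v)) <=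
  (cB (size s) j)%:R * var_n ^+ j * nrm2 v.
  apply: le_trans (IH _ _); first by apply: ler_sum => O _; exact: ctr_act.
  by move=> x xs; apply: cs; rewrite inE xs orbT.
pose g O := act N (act (Cc s O) v).
apply: (@le_trans _ _ (\sum_(O : k.-tuple letter) k.+1%:R *
   (two_n * \sum_o nrm2 (g (o :: O)) + \sum_(z <- dels O) var_n ^+ 2 * nrm2 (act (unitE e z.1)%:M (g z.2))))).
  apply: ler_sum => O _ /=.
  rewrite actDl !act_suml.
  apply: le_trans (nrm2_add_seq _ _ _) _.
  rewrite size_dels size_tuple ler_wpM2l ?ler0n //.
  apply: lerD.
    rewrite (eq_bigr (fun o => act (unitE e o)%:M (g (o :: O)))); first exact: push_le.
    by move=> o _; rewrite !act_mul.
  rewrite le_eqVlt; apply/orP; left; apply/eqP; apply: eq_bigr => z _.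
  rewrite !act_mul !act_scalar linearZ /= -scalemxAr nrm2Z.
  by rewrite (ger0_norm s2_ge0).
rewrite -mulr_sumr big_split /= -mulr_sumr natrM -!mulrA.
rewrite ler_wpM2l ?ler0n // natrD mulrDl; apply: lerD.
  rewrite exchange_big -(sum_tupleS _ (fun O => nrm2 (g O))).
  have := ler_wpM2l tn_ge0 (IH k.+1); move/le_trans; apply.
  rewrite exprS le_eqVlt; apply/orP; left; apply/eqP.
  have -> : two_n * ((cB (size s) k.+1)%:R * (var_n * var_n ^+ k) * nrm2 v) =
    two_n * var_n * ((cB (size s) k.+1)%:R * (var_n ^+ k * nrm2 v)) by ring.
  by rewrite mulfV ?tn_neq0 // mul1r.
case: k {cs} => [|k] /=.
  rewrite (sum_tuple0 (fun O => \sum_(z <- dels O) var_n ^+ 2 * nrm2 (act (unitE e z.1)%:M (g z.2)))).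
  by rewrite big_nil mul0r.
rewrite (sum_tuple_dels _ (fun o O => var_n ^+ 2 * nrm2 (act (unitE e o)%:M (g O)))).
have -> : \sum_o \sum_(t : k.-tuple letter) var_n ^+ 2 * nrm2 (act (unitE e o)%:M (g t)) =
    var_n * \sum_(t : k.-tuple letter) nrm2 (g t).
  rewrite exchange_big mulr_sumr; apply: eq_bigr => t _.
  rewrite -mulr_sumr sum_act_unitE expr2 -mulrA [var_n * (two_n * _)]mulrA mulVf ?tn_neq0 //.
  by rewrite mul1r.
rewrite -[leLHS]mulr_natl natrM exprS.
have -> : k.+1%:R * (cB (size s) k)%:R * (var_n * var_n ^+ k * nrm2 v) =
  k.+1%:R * (var_n * ((cB (size s) k)%:R * var_n ^+ k * nrm2 v)) by ring.
by rewrite !ler_wpM2l ?ler0n ?s2_ge0 // IH.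
Qed.
End Letters.

(** * Products of open letters and crossing contractions *)

Section Rows.
Variables (C : numClosedFieldType) (n p : nat).
Local Notation M := 'M['M[C]_n]_p.
Local Notation letter := ('I_n * 'I_n * bool)%type.
Local Notation unitE := (@unitE C n).
Local Notation tn := (two_n C n).
Local Notation s2 := (var_n C n).
Hypothesis n_gt0 : (0 < n)%N.

Let tn_ge0 : 0 <= tn. Proof. exact: ler0n. Qed.
Let s2_ge0 : 0 <= s2. Proof. by rewrite invr_ge0 tn_ge0. Qed.

Fixpoint Rr (N0 : M) (st : seq (bool * M)) (O : seq letter) : M :=
  match st, O with
  | (e, N) :: st', o :: O' => Rr N0 st' O' *m (unitE e o)%:M *m N
  | _, _ => N0
  end.

(** Letters carry no weight on this side, so [tn ^+ size st] is the exact inverse of the power of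
    [var_n] in [Cc_bound]. *)
Lemma Rr_bound N0 st v : ctr N0 -> (forall x, x \in st -> ctr x.2) ->
  \sum_(O : (size st).-tuple letter) nrm2 (lact v (Rr N0 st O)) <=
  tn ^+ size st * nrm2 v.
Proof.
move=> c0; elim: st => [|[e N] st IH] cs /=.
  rewrite (sum_tuple0 (fun O => nrm2 (lact v (Rr N0 [::] O)))) expr0 mul1r.
  exact: ctr_lact.
rewrite (sum_tupleS _ (fun O => nrm2 (lact v (Rr N0 ((e, N) :: st) O)))) exchange_big /=.
have cN : ctr N by apply: (cs (e, N)); rewrite inE eqxx.
apply: (@le_trans _ _ (\sum_(O : (size st).-tuple letter) tn * nrm2 (lact v (Rr N0 st O)))).
  apply: ler_sum => O _; rewrite -(sum_lact_unitE e).
  by apply: ler_sum => o _; rewrite !lact_mul; exact: ctr_lact.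
rewrite -mulr_sumr exprS -mulrA ler_wpM2l //; apply: IH => x xs.
by apply: cs; rewrite inE xs orbT.
Qed.

Lemma block_le' (N : M) k l (x : 'I_n -> C) : ctr N ->
  \sum_d `|\sum_s x s * N k l d s| ^+ 2 <= \sum_s `|x s| ^+ 2.
Proof.
move=> cN; have := block_le k l (\col_s x s) cN; rewrite !nrm2_cV.
under eq_bigr do rewrite mxE.
under [X in _ <= X -> _]eq_bigr do rewrite mxE.
apply: le_trans; rewrite le_eqVlt; apply/orP; left; apply/eqP.
apply: eq_bigr => d _; congr (`|_| ^+ 2); apply: eq_bigr => s _.
by rewrite mxE mulrC.
Qed.

(* The partial transpose of the contraction [N] has norm at most [p]: here it is
   applied to the vectors [theta s], one for each value [s] of the index that the
   trace identifies. *)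
Lemma transpose_le (N : M) (theta : 'I_n -> 'M[C]_(p, n)) : ctr N ->
  \sum_c \sum_d \sum_l `|\sum_s \sum_q theta s q c * N q l d s| ^+ 2 <=
  p%:R ^+ 2 * \sum_s nrm2 (theta s).
Proof.
move=> cN.
apply: (@le_trans _ _ (\sum_c \sum_(l < p) p%:R * \sum_q \sum_s `|theta s q c| ^+ 2)).
  apply: ler_sum => c _; rewrite exchange_big; apply: ler_sum => l _ /=.
  apply: (@le_trans _ _ (\sum_d p%:R * \sum_q `|\sum_s theta s q c * N q l d s| ^+ 2)).
    apply: ler_sum => d _; rewrite exchange_big /= -[X in X%:R]card_ord.
    exact: normr_sum2.
  rewrite -mulr_sumr ler_wpM2l ?ler0n // exchange_big; apply: ler_sum => q _ /=.
  exact: (block_le' q l (fun s => theta s q c) cN).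
under eq_bigr do rewrite sumr_const card_ord -[(_ * _) *+ _]mulr_natl mulrA.
rewrite -mulr_sumr -expr2 le_eqVlt; apply/orP; left; apply/eqP; congr (_ * _).
rewrite exchange_big; under eq_bigr do rewrite exchange_big.
by rewrite exchange_big.
Qed.

(** The matrix unit cuts the trace open. What remains contracts the row index of [N] in C^p together
    with its column index in C^n: a partial transpose. *)
Lemma ptr_unitE x (P : M) e o (N : M) l :
  ((ptr (P *m (unitE e o)%:M *m N))^T *m x) l 0 =
  n%:R^-1 * kap C e o.2 * \sum_s \sum_q lact (tens x s) P q (if e then o.1.1 else o.1.2)
     * N q l (if e then o.1.2 else o.1.1) s.
Proof.
set a := if e then o.1.1 else o.1.2; set b := if e then _ else _.
have lE s q : lact (tens x s) P q a = \sum_k x k 0 * P k q s a.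
  rewrite mxE; apply: eq_bigr => k _; rewrite (bigD1 s) //=.
  rewrite [X in _ + X]big1 ?addr0 => [|i is_]; rewrite tensE ?eqxx ?mulr1 //.
  by rewrite (negbTE is_) mulr0 mul0r.
have EE : unitE e o = kap C e o.2 *: delta_mx a b by rewrite /unitE /a /b; case: (e).
have D (A B : 'M[C]_n) s : (A *m unitE e o *m B) s s = kap C e o.2 * (A s a * B b s).
  rewrite EE -scalemxAr -scalemxAl mxE; congr (_ * _).
  rewrite mxE (bigD1 b) //= [X in _ + X]big1 ?addr0.
    rewrite mxE (bigD1 a) //= [X in _ + X]big1 ?addr0.
      by rewrite !mxE !eqxx mulr1.
    by move=> z za; rewrite !mxE (negbTE za) mulr0.
  move=> z zb; rewrite [X in X * _]mxE big1 ?mul0r // => y _.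
  by rewrite !mxE (negbTE zb) andbF mulr0.
rewrite mxE.
transitivity (\sum_k \sum_q \sum_s n%:R^-1 * kap C e o.2 * (x k 0 * P k q s a * N q l b s)).
  apply: eq_bigr => k _; rewrite [X in X * _]mxE [X in X * _]mxE [(_ *m _) k l]mxE.
  rewrite raddf_sum mulr_sumr mulr_suml; apply: eq_bigr => q _; rewrite mul_scalarE.
  rewrite /mxtrace mulr_sumr mulr_suml; apply: eq_bigr => s _.
  by rewrite -[_ *m _ * _]/(_ *m _ *m _) D; ring.
rewrite mulr_sumr; under [RHS]eq_bigr do rewrite mulr_sumr.
rewrite [RHS]exchange_big [LHS]exchange_big. apply: eq_bigr => q _.
rewrite exchange_big; apply: eq_bigr => s _ /=.
rewrite lE mulr_suml mulr_sumr. by apply: eq_bigr.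
Qed.

Lemma lact0 v : lact v (0 : M) = 0.
Proof.
apply/matrixP => k a; rewrite !mxE big1 // => l _; rewrite big1 // => b _.
by rewrite !mxE mulr0.
Qed.

(** The growth of [Rr_bound], asked of a product [Q] of the letters between the closed one and the
    innermost one. *)
Definition row_le q (Q : seq letter -> M) : Prop :=
  forall v, \sum_(O : q.-tuple letter) nrm2 (lact v (Q O)) <= tn ^+ q * nrm2 v.

(** The 2 counts the components of the letter, 1/n^2 comes from the normalized trace and p^2 from
    [transpose_le]. *)
Lemma ptr_unitE_le x (P : M) e N : ctr N ->
  \sum_o nrm2 ((ptr (P *m (unitE e o)%:M *m N))^T *m x) <=
  2 * (p%:R / n%:R) ^+ 2 * \sum_s nrm2 (lact (tens x s) P).
Proof.
move=> cN; rewrite sum_letter.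
pose X c d l := `|\sum_s \sum_q lact (tens x s) P q c * N q l d s| ^+ 2.
have E o : nrm2 ((ptr (P *m (unitE e o)%:M *m N))^T *m x) =
   n%:R^-1 ^+ 2 * \sum_l X (if e then o.1.1 else o.1.2) (if e then o.1.2 else o.1.1) l.
  rewrite nrm2_cV mulr_sumr; apply: eq_bigr => l _; rewrite ptr_unitE !normrM !exprMn.
  by rewrite norm_kap mulr1 ger0_norm ?invr_ge0 ?ler0n.
under eq_bigr do under eq_bigr do under eq_bigr do rewrite E.
have -> : \sum_a \sum_b \sum_(t : bool) n%:R^-1 ^+ 2 *
    (\sum_l X (if e then a else b) (if e then b else a) l) =
    2 * n%:R^-1 ^+ 2 * \sum_c \sum_d \sum_l X c d l.
  have T (F : 'I_n -> 'I_n -> C) : \sum_a \sum_b \sum_(t : bool) n%:R^-1 ^+ 2 * F a b =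
      2 * n%:R^-1 ^+ 2 * \sum_c \sum_d F c d.
    rewrite mulr_sumr; apply: eq_bigr => a _; rewrite mulr_sumr; apply: eq_bigr => b _.
    by rewrite sumr_const card_bool -[LHS]mulr_natl mulrA.
  case: (e); first by rewrite (T (fun a b => \sum_l X a b l)).
  by rewrite (T (fun a b => \sum_l X b a l)) exchange_big.
have := transpose_le (fun s => lact (tens x s) P) cN; rewrite -/X => h.
have -> : 2 * (p%:R / n%:R) ^+ 2 * \sum_s nrm2 (lact (tens x s) P) =
   2 * n%:R^-1 ^+ 2 * (p%:R ^+ 2 * \sum_s nrm2 (lact (tens x s) P)) by ring.
by apply: ler_wpM2l h; rewrite mulr_ge0 ?ler0n ?exprn_ge0 ?invr_ge0 ?ler0n.
Qed.

(** The [n] basis vectors [tens x s] and the 2 of [ptr_unitE_le] make one more factor 2n, the usual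
    cost of the letter [o]; the gain is (p/n)^2. *)
Lemma partial_row_le q Q e N (w : 'M[C]_(p, n)) : ctr N -> row_le q Q ->
  \sum_(O : q.-tuple letter) \sum_o
    nrm2 (lact w (scal (ptr (Q O *m (unitE e o)%:M *m N)))) <=
  (p%:R / n%:R) ^+ 2 * tn ^+ q.+1 * nrm2 w.
Proof.
move=> cN Qle.
under eq_bigr do under eq_bigr do rewrite lact_scal nrm2_col.
under eq_bigr do rewrite exchange_big.
rewrite exchange_big [X in _ * X]nrm2_col mulr_sumr; apply: ler_sum => a _ /=.
set x := col a w.
apply: (@le_trans _ _ (\sum_(O : q.-tuple letter)
   2 * (p%:R / n%:R) ^+ 2 * \sum_s nrm2 (lact (tens x s) (Q O)))).
  apply: ler_sum => O _.
  under eq_bigr do rewrite colE -mulmxA -colE.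
  exact: ptr_unitE_le.
rewrite -mulr_sumr exchange_big /=.
apply: (@le_trans _ _ (2 * (p%:R / n%:R) ^+ 2 * \sum_(s < n) (tn ^+ q * nrm2 x))).
  apply: ler_wpM2l; first by rewrite mulr_ge0 ?exprn_ge0 ?divr_ge0 ?ler0n.
  by apply: ler_sum => s _; rewrite -(nrm2_tens x s); exact: Qle.
rewrite sumr_const card_ord -[(_ * _) *+ n]mulr_natl [tn ^+ q.+1]exprS le_eqVlt; apply/orP; left; apply/eqP.
rewrite /two_n natrM. ring.
Qed.

(* Closing a letter that is not the innermost open one. *)
Section NonPlanar.
Variables (N0 : M) (e1 : bool) (N1 : M) (e : bool) (N : M) (s : seq (bool * M)).
Hypotheses (cN0 : ctr N0) (cN1 : ctr N1) (cN : ctr N).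
Hypothesis cs : forall x, x \in s -> ctr x.2.

(** [e1] is the innermost open letter and stays open. [Q] collects the letters passed over,
    outermost first, whence the [catrev]. *)
Definition NPsum (st : seq (bool * M)) q (Q : seq letter -> M) : M :=
  \sum_(O : (size st).-tuple letter) \sum_o \sum_(OQ : q.-tuple letter)
    \sum_(z <- dels O)
      Rr N0 st O *m Q OQ *m (unitE e1 o)%:M *m N1 *m (s2 *: unitE e z.1)%:M *m N
        *m Cc s (o :: catrev OQ z.2).

(** The part of [NPsum] in which the letter [e'] on top of [st] is closed: all from [N'] to [N1]
    falls inside the partial trace. *)
Definition NPclosed (e' : bool) (N' : M) st q (Q : seq letter -> M) : M :=
  \sum_(O : (size st).-tuple letter) \sum_o \sum_(OQ : q.-tuple letter)
    Rr N0 st O *m (if e' == e then 0 else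
       scal (ptr (N' *m Q OQ *m (unitE e1 o)%:M *m N1))) *m N
    *m Cc s (o :: catrev OQ O).

Definition consQ (e' : bool) (N' : M) (Q : seq letter -> M) (O : seq letter) : M :=
  if O is o :: O' then (unitE e' o)%:M *m N' *m Q O' else 0.

(** The closing letter meets the head of the stack, which [planar] evaluates, or the head is passed
    over and moves into [Q]. *)
Lemma NPsum_cons e' N' st q Q :
  NPsum ((e', N') :: st) q Q =
  NPclosed e' N' st q Q + NPsum st q.+1 (consQ e' N' Q).
Proof.
rewrite /NPsum.
pose T (O : seq letter) (o : letter) (OQ : seq letter) (z : letter * seq letter) :=
  Rr N0 ((e', N') :: st) O *m Q OQ *m (unitE e1 o)%:M *m N1 *m (s2 *: unitE e z.1)%:M *m N
        *m Cc s (o :: catrev OQ z.2).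
rewrite (sum_tupleS _ (fun O => \sum_o \sum_(OQ : q.-tuple letter)
   \sum_(z <- dels O) T O o OQ z)).
rewrite exchange_big /=.
under eq_bigr do under eq_bigr do under eq_bigr do under eq_bigr do rewrite big_dels_cons /=.
under eq_bigr do under eq_bigr do under eq_bigr do rewrite big_split /=.
under eq_bigr do under eq_bigr do rewrite big_split /=.
under eq_bigr do rewrite big_split /=.
rewrite big_split /=; congr (_ + _).
  apply: eq_bigr => O _; rewrite exchange_big; apply: eq_bigr => o _.
  rewrite exchange_big; apply: eq_bigr => OQ _.
  rewrite -(planar n_gt0) mulmx_sumr !mulmx_suml; apply: eq_bigr => o' _.
  by rewrite /T /= !mulmxA.
apply: eq_bigr => O _; rewrite exchange_big; apply: eq_bigr => o _.
rewrite (sum_tupleS _ (fun OQ => \sum_(z <- dels O)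
  Rr N0 st O *m consQ e' N' Q OQ *m (unitE e1 o)%:M *m N1 *m (s2 *: unitE e z.1)%:M *m N
        *m Cc s (o :: catrev OQ z.2))).
apply: eq_bigr => o' _; apply: eq_bigr => OQ _; apply: eq_bigr => z _.
by rewrite /T /= !mulmxA.
Qed.

Lemma consQ_le e' N' q Q : ctr N' -> row_le q Q -> row_le q.+1 (consQ e' N' Q).
Proof.
move=> cN' Qle v.
rewrite (sum_tupleS _ (fun O => nrm2 (lact v (consQ e' N' Q O)))) /=.
apply: (@le_trans _ _ (\sum_o tn ^+ q * nrm2 (lact v (unitE e' o)%:M))).
  apply: ler_sum => o _; under eq_bigr do rewrite !lact_mul.
  apply: le_trans (Qle _) _; apply: ler_wpM2l; first exact: exprn_ge0.
  exact: ctr_lact.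
by rewrite -mulr_sumr sum_lact_unitE exprSr mulrA.
Qed.

Lemma mulQ_le N' q Q : ctr N' -> row_le q Q -> row_le q (fun O => N' *m Q O).
Proof.
move=> cN' Qle v; under eq_bigr do rewrite lact_mul.
apply: le_trans (Qle _) _; apply: ler_wpM2l; first exact: exprn_ge0.
exact: ctr_lact.
Qed.

(** One Cauchy-Schwarz over the basis vector and all open letters at once. With k = q + size st + 1,
    the left factor is (p/n)^2 (2n)^k by [partial_row_le] and [Rr_bound], the right one (2n)^-k by
    [Cc_bound]; the basis vectors give n twice, absorbed by the squared 1/n of [dot_ptr]. *)
Lemma NPclosed_le e' N' st q Q (x y : 'cV[C]_p) : ctr N' -> row_le q Q ->
  (forall x, x \in st -> ctr x.2) ->
  `|dot x (ptr (NPclosed e' N' st q Q) *m y)| ^+ 2 <=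
  (cB (size s) (q + size st).+1)%:R * (p%:R / n%:R) ^+ 2 * nrm2 x * nrm2 y.
Proof.
move=> cN' Qle cst; rewrite dot_ptr normrM exprMn.
pose I := ('I_n * ((size st).-tuple letter * (letter * q.-tuple letter)))%type.
pose K (OQ : seq letter) o : M :=
  if e' == e then 0 else scal (ptr (N' *m Q OQ *m (unitE e1 o)%:M *m N1)).
pose U (i : I) := lact (lact (tens x i.1) (Rr N0 st i.2.1)) (K i.2.2.2 i.2.2.1).
pose V (i : I) := act N (act (Cc s (i.2.2.1 :: catrev i.2.2.2 i.2.1)) (tens y i.1)).
have pr (F : 'I_n -> (size st).-tuple letter -> letter -> q.-tuple letter -> C) :
  \sum_j \sum_O \sum_o \sum_OQ F j O o OQ = \sum_(i : I) F i.1 i.2.1 i.2.2.1 i.2.2.2.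
  rewrite -(pair_bigA _ (fun j z => F j z.1 z.2.1 z.2.2)) /=; apply: eq_bigr => j _.
  rewrite -(pair_bigA _ (fun O z => F j O z.1 z.2)) /=; apply: eq_bigr => O _.
  by rewrite pair_bigA.
have -> : \sum_j dot (tens x j) (act (NPclosed e' N' st q Q) (tens y j)) =
    \sum_i dot (U i) (V i).
  rewrite -(pr (fun j O o OQ => dot (lact (lact (tens x j) (Rr N0 st O)) (K OQ o))
    (act N (act (Cc s (o :: catrev OQ O)) (tens y j))))).
  apply: eq_bigr => j _; rewrite act_suml dot_sumr; apply: eq_bigr => O _.
  rewrite act_suml dot_sumr; apply: eq_bigr => o _.
  rewrite act_suml dot_sumr; apply: eq_bigr => OQ _.
  by rewrite !act_mul !dot_act.
have hU : \sum_i nrm2 (U i) <=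
    n%:R * ((p%:R / n%:R) ^+ 2 * tn ^+ (q + size st).+1 * nrm2 x).
  rewrite -(pr (fun j O o OQ => nrm2 (lact (lact (tens x j) (Rr N0 st O)) (K OQ o)))).
  rewrite mulr_natl -[X in _ *+ X]card_ord -sumr_const; apply: ler_sum => j _.
  apply: (@le_trans _ _ (\sum_(O : (size st).-tuple letter)
     (p%:R / n%:R) ^+ 2 * tn ^+ q.+1 * nrm2 (lact (tens x j) (Rr N0 st O)))).
    apply: ler_sum => O _; rewrite exchange_big /K; case: eqP => _.
      rewrite big1 ?mulr_ge0 ?exprn_ge0 ?divr_ge0 ?ler0n ?nrm2_ge0 // => OQ _.
      by rewrite big1 // => o _; rewrite lact0 nrm20.
    exact: (partial_row_le _ _ cN1 (mulQ_le cN' Qle)).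
  rewrite -mulr_sumr -addSn exprD mulrA -[leRHS]mulrA; apply: ler_wpM2l.
    by rewrite mulr_ge0 ?exprn_ge0 ?divr_ge0 ?ler0n.
  by rewrite -(nrm2_tens x j); exact: Rr_bound.
have hV : \sum_i nrm2 (V i) <=
    n%:R * ((cB (size s) (q + size st).+1)%:R * s2 ^+ (q + size st).+1 * nrm2 y).
  rewrite -(pr (fun j O o OQ => nrm2 (act N (act (Cc s (o :: catrev OQ O)) (tens y j))))).
  rewrite mulr_natl -[X in _ *+ X]card_ord -sumr_const; apply: ler_sum => j _.
  rewrite -(nrm2_tens y j).
  apply: le_trans (Cc_bound n_gt0 _ _ cs).
  rewrite (sum_tupleS _ (fun O => nrm2 (act (Cc s O) (tens y j)))) exchange_big /=.
  apply: ler_sum => o _.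
  rewrite -(sum_tuple_catrev _ _ (fun O => nrm2 (act (Cc s (o :: O)) (tens y j)))).
  rewrite exchange_big; apply: ler_sum => O _; apply: ler_sum => OQ _.
  exact: ctr_act.
have n0 : (n%:R : C) != 0 by rewrite pnatr_eq0 -lt0n.
apply: (@le_trans _ _ (`|n%:R^-1| ^+ 2 *
   ((n%:R * ((p%:R / n%:R) ^+ 2 * tn ^+ (q + size st).+1 * nrm2 x)) *
   (n%:R * ((cB (size s) (q + size st).+1)%:R * s2 ^+ (q + size st).+1 * nrm2 y))))).
  apply: ler_wpM2l; first exact: exprn_ge0.
  apply: le_trans (dot_cs_sum _ _) _.
  by apply: ler_pM => //; apply: sumr_ge0 => i _; exact: nrm2_ge0.
rewrite le_eqVlt; apply/orP; left; apply/eqP.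
rewrite ger0_norm ?invr_ge0 ?ler0n //.
have t0 : tn ^+ (q + size st).+1 != 0 by rewrite expf_neq0 // tn_neq0.
have -> : s2 ^+ (q + size st).+1 = (tn ^+ (q + size st).+1)^-1 by rewrite exprVn.
move: (tn ^+ _) t0 => t t0.
by field; rewrite n0 t0.
Qed.
End NonPlanar.
End Rows.

(** * Propagation of the crossing errors through the recursion *)

Section Comparison.
Variables (C : numClosedFieldType) (n p : nat).
Local Notation M := 'M['M[C]_n]_p.
Local Notation letter := ('I_n * 'I_n * bool)%type.
Local Notation unitE := (@unitE C n).
Local Notation s2 := (var_n C n).
Hypothesis n_gt0 : (0 < n)%N.

Lemma ptrD (N P : M) : ptr (N + P) = ptr N + ptr P.
Proof. by apply/matrixP => k l; rewrite !mxE raddfD mulrDr. Qed.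

Lemma ptr0 : ptr (0 : M) = 0.
Proof. by apply/matrixP => k l; rewrite !mxE raddf0 mulr0. Qed.

Lemma normr3_le (a b c : C) :
  `|a + b + c| ^+ 2 <= 3%:R * (`|a| ^+ 2 + `|b| ^+ 2 + `|c| ^+ 2).
Proof.
have := normr_seq_sum2 [:: 0%N; 1%N; 2%N] (fun i => nth 0 [:: a; b; c] i).
by rewrite !big_cons !big_nil /= !addr0 !addrA.
Qed.

Section NonPlanarBound.
Variables (N0 : M) (e1 : bool) (N1 : M) (e : bool) (N : M) (s : seq (bool * M)).
Hypotheses (cN0 : ctr N0) (cN1 : ctr N1) (cN : ctr N).
Hypothesis cs : forall x, x \in s -> ctr x.2.
Local Notation NPs := (NPsum N0 e1 N1 e N s).

(** Passing over a letter doubles the bound through [normr2_add], and 2 (1 + 4^k) <= 4^(k+1); the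
    index [q + size st] of [cB] stays fixed. *)
Lemma NPsum_le st q Q (x y : 'cV[C]_p) : row_le q Q ->
  (forall x, x \in st -> ctr x.2) ->
  `|dot x (ptr (NPs st q Q) *m y)| ^+ 2 <=
  (4 ^ size st * cB (size s) (q + size st))%:R * (p%:R / n%:R) ^+ 2 * nrm2 x * nrm2 y.
Proof.
elim: st q Q => [|[e' N'] st IH] q Q Qle cst.
  have -> : NPs [::] q Q = 0.
    rewrite /NPsum (sum_tuple0 (fun O => \sum_o \sum_(OQ : q.-tuple letter)
      \sum_(z <- dels O)
      Rr N0 [::] O *m Q OQ *m (unitE e1 o)%:M *m N1 *m (s2 *: unitE e z.1)%:M *m N
        *m Cc s (o :: catrev OQ z.2))).
    by rewrite big1 // => o _; rewrite big1 // => OQ _; rewrite big_nil.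
  by rewrite ptr0 mul0mx dot0r normr0 expr0n !mulr_ge0 ?exprn_ge0 ?divr_ge0 ?nrm2_ge0 ?ler0n.
rewrite NPsum_cons // ptrD mulmxDl dotDr.
have cN' : ctr N' by apply: (cst (e', N')); rewrite inE eqxx.
have cst' z : z \in st -> ctr z.2 by move=> zs; apply: cst; rewrite inE zs orbT.
apply: le_trans (normr2_add _ _) _.
have h1 := NPclosed_le n_gt0 e1 e cN0 cN1 cN cs e' x y cN' Qle cst'.
have h2 := IH _ _ (consQ_le e' cN' Qle) cst'.
rewrite -addSnnS /=.
apply: (@le_trans _ _ (((cB (size s) (q + size st).+1)%:R * (p%:R / n%:R) ^+ 2 * nrm2 x * nrm2 y
  + (4 ^ size st * cB (size s) (q.+1 + size st))%:R * (p%:R / n%:R) ^+ 2 * nrm2 x * nrm2 y) *+ 2)).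
  by rewrite lerMn2r /= lerD.
rewrite addSn -!mulrDl -!mulrnAl.
do 3![apply: ler_wpM2r; first by rewrite ?exprn_ge0 ?divr_ge0 ?nrm2_ge0 ?ler0n].
rewrite -natrD -mulr_natl -natrM ler_nat expnS.
have : (0 < 4 ^ size st)%N by rewrite expn_gt0.
move: (4 ^ _)%N (cB _ _) => a b; nia.
Qed.
End NonPlanarBound.

(* A state [z] is a word [z.1 x_1 N_1 ... x_k N_k] of open letters, stored with
   the last letter first; [mtop z K] multiplies it by [K] on the right. *)
Definition mtop (z : M * seq (bool * M)) (K : M) : M * seq (bool * M) :=
  if z.2 is (e, N) :: st then (z.1, (e, N *m K) :: st) else (z.1 *m K, [::]).

Lemma size_mtop z K : size (mtop z K).2 = size z.2.
Proof. by case: z => N0 [|[e N] st]. Qed.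

(** The expectation of the state times the unread word [s], with every open letter paired with a
    letter of [s]. *)
Definition Gm (z : M * seq (bool * M)) (s : seq (bool * M)) : M :=
  \sum_(O : (size z.2).-tuple letter) Rr z.1 z.2 O *m Cc s O.

Lemma Rr_mtop N0 st K (O : (size st).-tuple letter) :
  Rr (mtop (N0, st) K).1 (mtop (N0, st) K).2 O = Rr N0 st O *m K.
Proof.
case: st O => [|[e N] st] [[|o O] i] //=; by rewrite !mulmxA.
Qed.

(** The deeper closings enter as [NPsum] with nothing passed over yet, hence [q = 0] and [Q = 1]. *)
Lemma Gm_step N0 st e N s :
  Gm (N0, st) ((e, N) :: s) = Gm (N0, (e, N) :: st) s +
  (if st is (e1, N1) :: st1 then
     (if e1 == e then 0 else Gm (mtop (N0, st1) (scal (ptr N1) *m N)) s) +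
     NPsum N0 e1 N1 e N s st1 0 (fun=> 1%:M)
   else 0).
Proof.
have -> : Gm (N0, st) ((e, N) :: s) =
  \sum_(O : (size st).-tuple letter) Rr N0 st O *m
   (\sum_o (unitE e o)%:M *m N *m Cc s (o :: O) +
    \sum_(z <- dels O) (s2 *: unitE e z.1)%:M *m N *m Cc s z.2) by [].
under eq_bigr do rewrite mulmxDr.
rewrite big_split; congr (_ + _).
  have -> : Gm (N0, (e, N) :: st) s = \sum_(O : (size st).+1.-tuple letter)
    Rr N0 ((e, N) :: st) O *m Cc s O by [].
  rewrite (sum_tupleS _ (fun O => Rr N0 ((e, N) :: st) O *m Cc s O)) exchange_big.
  apply: eq_bigr => O _; rewrite mulmx_sumr; apply: eq_bigr => o _.
  by rewrite /= !mulmxA.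
case: st => [|[e1 N1] st].
  rewrite (sum_tuple0 (fun O => Rr N0 [::] O *m \sum_(z <- dels O)
    (s2 *: unitE e z.1)%:M *m N *m Cc s z.2)).
  by rewrite big_nil mulmx0.
rewrite (sum_tupleS _ (fun O => Rr N0 ((e1, N1) :: st) O *m \sum_(z <- dels O)
    (s2 *: unitE e z.1)%:M *m N *m Cc s z.2)).
under eq_bigr do under eq_bigr do rewrite big_dels_cons mulmxDr.
under eq_bigr do rewrite big_split.
rewrite big_split /=; congr (_ + _).
  rewrite exchange_big /=.
  have H (O : seq letter) : \sum_(o : letter) Rr N0 st O *m (unitE e1 o)%:M *m N1 *m
      ((s2 *: unitE e o)%:M *m N *m Cc s O) =
      Rr N0 st O *m (if e1 == e then 0 else scal (ptr N1)) *m N *m Cc s O.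
    rewrite -(planar n_gt0) mulmx_sumr !mulmx_suml; apply: eq_bigr => o _.
    by rewrite !mulmxA.
  under eq_bigr do rewrite H.
  case: eqP => _; first by rewrite big1 // => O _; rewrite mulmx0 !mul0mx.
  rewrite /Gm size_mtop; apply: eq_bigr => O _.
  by rewrite Rr_mtop !mulmxA.
rewrite /NPsum exchange_big; apply: eq_bigr => O _; apply: eq_bigr => o _.
rewrite (sum_tuple0 (fun OQ => \sum_(z <- dels O)
   Rr N0 st O *m 1%:M *m (unitE e1 o)%:M *m N1 *m (s2 *: unitE e z.1)%:M *m N *m
      Cc s (o :: catrev OQ z.2))).
rewrite mulmx_sumr; apply: eq_bigr => z _.
by rewrite mulmx1 !mulmxA.
Qed.

(** One summand per alternative of [Gm_step], the last being the constant of [NPsum_le]; the 3 is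
    Cauchy-Schwarz for three terms. *)
Fixpoint cD (r k : nat) : nat :=
  if r is r'.+1 then
    (3 * (cD r' k.+1 + cD r' k.-1 + 4 ^ k.-1 * cB r' k.-1))%N
  else 0%N.

Definition ctr_state (z : M * seq (bool * M)) : Prop :=
  ctr z.1 /\ forall x, x \in z.2 -> ctr x.2.

Variable F : M * seq (bool * M) -> seq (bool * M) -> 'M[C]_p.
Hypothesis F_nil : forall N0 st, F (N0, st) [::] = if st is [::] then ptr N0 else 0.
Hypothesis F_step : forall N0 st e N s,
  F (N0, st) ((e, N) :: s) = F (N0, (e, N) :: st) s +
  (if st is (e1, N1) :: st1 then
     (if e1 == e then 0 else F (mtop (N0, st1) (scal (ptr N1) *m N)) s)
   else 0).

(** [F] is any solution of the recursion without [NPsum], so only the crossing errors accumulate.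
    The induction covers all contractive states: an innermost closing multiplies the top matrix by
    [scal (ptr N1) *m N], a contraction by [ctr_ptr]. *)
Theorem genus_bound z s (x y : 'cV[C]_p) : ctr_state z -> (forall x, x \in s -> ctr x.2) ->
  `|dot x ((ptr (Gm z s) - F z s) *m y)| ^+ 2 <=
  (cD (size s) (size z.2))%:R * (p%:R / n%:R) ^+ 2 * nrm2 x * nrm2 y.
Proof.
elim: s z => [|[e N] s IH] [N0 st] [/= cN0 cst] cs.
  have -> : ptr (Gm (N0, st) [::]) - F (N0, st) [::] = 0.
    rewrite F_nil; apply/eqP; rewrite subr_eq0; apply/eqP.
    case: st {cst} => [|[e N] st].
      rewrite /Gm (sum_tuple0 (fun O => Rr N0 [::] O *m Cc [::] O)) /=.
      by rewrite mulmx1.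
    rewrite /Gm big1 ?ptr0 // => O _; case: O => [[|o O] i] //=.
    by rewrite mulmx0.
  by rewrite mul0mx dot0r normr0 expr0n !mulr_ge0 ?exprn_ge0 ?divr_ge0 ?nrm2_ge0 ?ler0n.
have cN : ctr N by apply: (cs (e, N)); rewrite inE eqxx.
have {}cs u : u \in s -> ctr u.2 by move=> us; apply: cs; rewrite inE us orbT.
have c1 : ctr_state (N0, (e, N) :: st).
  by split => // u; rewrite inE => /orP[/eqP ->//|]; exact: cst.
rewrite Gm_step F_step ptrD.
set G1 := ptr (Gm _ s); set F1 := F _ s.
have h1 := IH _ c1 cs; rewrite -/G1 -/F1 /= in h1.
set B := (p%:R / n%:R) ^+ 2 in h1 *.
have B0 : 0 <= B by rewrite exprn_ge0 ?divr_ge0 ?ler0n.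
case: st {c1} @G1 @F1 h1 cst => [|[e1 N1] st] G1 F1 h1 cst.
  rewrite ptr0 !addr0; apply: le_trans h1 _; rewrite -/B.
  do 3![apply: ler_wpM2r => //; rewrite ?nrm2_ge0 //].
  by rewrite ler_nat /=; move: (_ * cB _ _)%N (cD _ 1) (cD _ 0) => a b c; lia.
have cN1 : ctr N1 by apply: (cst (e1, N1)); rewrite inE eqxx.
have {}cst u : u \in st -> ctr u.2 by move=> us; apply: cst; rewrite inE us orbT.
rewrite ptrD.
set F2 := if _ then _ else F _ _; set NP := ptr (NPsum _ _ _ _ _ _ _ _ _).
set G2 := ptr _.
have -> : G1 + (G2 + NP) - (F1 + F2) = (G1 - F1) + (G2 - F2) + NP.
  by rewrite addrA [_ + NP - _]addrAC opprD addrACA.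
have h2 : `|dot x ((G2 - F2) *m y)| ^+ 2 <= (cD (size s) (size st))%:R * B * nrm2 x * nrm2 y.
  rewrite /G2 /F2; case: eqP => _.
    by rewrite ptr0 subrr mul0mx dot0r normr0 expr0n !mulr_ge0 ?nrm2_ge0 ?ler0n.
  rewrite -(size_mtop (N0, st) (scal (ptr N1) *m N)); apply: IH => //.
  have cK : ctr (scal (ptr N1) *m N) by apply: ctr_mul => //; exact: ctr_ptr.
  case: st {h1 G1 F1 F2 NP G2} cst => [|[e' N'] st] cst; split => //=.
    exact: ctr_mul.
  move=> u; rewrite inE => /orP[/eqP ->|us] /=.
    by apply: ctr_mul => //; apply: (cst (e', N')); rewrite inE eqxx.
  by apply: cst; rewrite inE us orbT.
have h3 : `|dot x (NP *m y)| ^+ 2 <=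
    (4 ^ size st * cB (size s) (size st))%:R * B * nrm2 x * nrm2 y.
  apply: (NPsum_le e1 e cN0 cN1 cN cs (q := 0)) => // v.
  rewrite (sum_tuple0 (fun O => nrm2 (lact v 1%:M))) expr0 mul1r.
  exact: ctr_lact (@ctr1 _ _ _).
rewrite (mulmxDl _ NP) (mulmxDl (G1 - F1)) !dotDr; apply: le_trans (normr3_le _ _ _) _.
apply: (@le_trans _ _ (3%:R * ((cD (size s) (size st).+2)%:R * B * nrm2 x * nrm2 y +
   (cD (size s) (size st))%:R * B * nrm2 x * nrm2 y +
   (4 ^ size st * cB (size s) (size st))%:R * B * nrm2 x * nrm2 y))).
  by apply: ler_wpM2l; [exact: ler0n | exact: (lerD (lerD h1 h2) h3)].
rewrite le_eqVlt; apply/orP; left; apply/eqP.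
by rewrite /= natrM !natrD; ring.
Qed.
End Comparison.

(** * The semicircle law and Chebyshev polynomials *)

Section Semicircle.
Import numFieldNormedType.Exports.
Variable R : realType.
Local Notation mu := (@lebesgue_measure R).
Local Notation w x := (Num.sqrt (4 - x ^+ 2)).

Lemma continuous_weight (k : nat) : continuous (fun x : R => x ^+ k * w x).
Proof.
move=> x; apply: cvgM; first exact: exprn_continuous.
apply: (continuous_comp (f := fun x : R => 4 - x ^+ 2)); last exact: sqrt_continuous.
by apply: cvgB; [exact: cvg_cst | exact: exprn_continuous].
Qed.

Lemma integrable_weight (k : nat) :
  mu.-integrable `[-2, 2]%classic (EFin \o (fun x => x ^+ k * w x)).
Proof.
apply: continuous_compact_integrable; first exact: segment_compact.
by apply: continuous_subspaceT; exact: continuous_weight.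
Qed.

(* Integrate the derivative of [x ^+ k * (4 - x ^+ 2) * w x]. *)
Lemma weight_moment_rec (k : nat) :
  k.+3%:R * (\int[mu]_(x in `[(-2 : R), 2]) (x ^+ k.+1 * w x)) =
  4 * k%:R * (\int[mu]_(x in `[(-2 : R), 2]) (x ^+ k.-1 * w x)).
Proof.
pose F (x : R) := x ^+ k * (4 - x ^+ 2) * w x.
pose f (x : R) := 4 * k%:R * (x ^+ k.-1 * w x) - k.+3%:R * (x ^+ k.+1 * w x).
have cF : continuous F.
  move=> x; rewrite /F.
  have -> : (fun x : R => x ^+ k * (4 - x ^+ 2) * w x) =
     (fun x => 4 * (x ^+ k * w x) - x ^+ k.+2 * w x).
    by apply/funext => y; rewrite !exprS; ring.
  apply: cvgB; last exact: continuous_weight.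
  by apply: cvgM; [exact: cvg_cst | exact: continuous_weight].
have cf : continuous f.
  move=> x; apply: cvgB; apply: cvgM; by [exact: cvg_cst | exact: continuous_weight].
have dF (x : R) : x \in `]-2, 2[ -> is_derive x 1 F (f x).
  rewrite in_itv /= => /andP[x1 x2].
  have x0 : 0 < 4 - x ^+ 2 by nra.
  pose Q : {poly R} := 4%:P - 'X^2; pose P := 'X^k * Q.
  have Qx y : Q.[y] = 4 - y ^+ 2 by rewrite /Q !hornerE.
  have -> : F = (horner P) * (Num.sqrt \o horner Q).
    by apply/funext => y; rewrite /F /GRing.mul /= Qx /P hornerM Qx hornerXn.
  have d2 : is_derive x 1 (Num.sqrt \o horner Q) ((2 * w x)^-1 * Q^`().[x]).
    have Q0 : 0 < Q.[x] by rewrite Qx.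
    by rewrite -Qx; apply: is_derive1_comp (is_derive1_sqrt Q0) (is_derive_poly Q x).
  apply: is_derive_eq.
  have dQ : Q^`().[x] = - (2 * x).
    by rewrite /Q derivB derivC derivXn sub0r hornerN !hornerE; ring.
  have -> : P^`().[x] = k%:R * x ^+ k.-1 * (4 - x ^+ 2) - x ^+ k * (2 * x).
    rewrite /P derivM hornerD !hornerM Qx dQ derivXn hornerMn !hornerXn.
    by ring.
  rewrite /= dQ Qx /P hornerM Qx hornerXn.
  have w0 : w x != 0 by rewrite gt_eqF // sqrtr_gt0.
  have w2 : 4 - x ^+ 2 = w x ^+ 2 by rewrite sqr_sqrtr // ltW.
  have -> : x ^+ k * (4 - x ^+ 2) *: ((2 * w x)^-1 * - (2 * x)) = - (x ^+ k.+1 * w x).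
    have gen s : s != 0 -> x ^+ k * s ^+ 2 * ((2 * s)^-1 * - (2 * x)) = - (x ^+ k.+1 * s).
      by move=> s0; rewrite [x ^+ k.+1]exprS; field.
    by rewrite {1}w2; exact: gen.
  (* At [k = 0] the truncated [k.-1] is harmless, as its coefficient is 0. *)
  rewrite /f /GRing.scale /=; case: (k) => [|j]; first by rewrite !expr0 /=; ring.
  by rewrite !exprS /=; ring.
have h : (\int[mu]_(x in `[(-2)%R, 2%R]) (f x)%:E = 0)%E.
  rewrite (@continuous_FTC2 _ f F).
  - rewrite /F sqrrN; have -> : (4 : R) - 2 ^+ 2 = 0 by ring.
    by rewrite !(mulr0, mul0r) -EFinB subrr.
  - by rewrite ltrNl; lra.
  - by apply: continuous_subspaceT.
  - split => [x xI||]; first by apply: ex_derive; exact: dF.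
    + by apply: cvg_at_right_filter; exact: cF.
    + by apply: cvg_at_left_filter; exact: cF.
  - by move=> x xI; rewrite derive1E; apply: derive_val; exact: dF.
have : \int[mu]_(x in `[(-2 : R), 2]) f x = 0 by rewrite /Rintegral h.
have iw (a : R) j : mu.-integrable `[(-2 : R), 2]%classic (EFin \o (fun x => a * (x ^+ j * w x))).
  apply: continuous_compact_integrable; first exact: segment_compact.
  apply: continuous_subspaceT => x.
  by apply: cvgM; [exact: cvg_cst | exact: continuous_weight].
rewrite /f RintegralB // !RintegralZl //; try exact: integrable_weight.
by move/eqP; rewrite subr_eq0 => /eqP ->.
Qed.

Lemma semicircle_moment_rec (k : nat) :
  k.+3%:R * semicircle_moment R k.+1 = 4 * k%:R * semicircle_moment R k.-1.
Proof. by rewrite /semicircle_moment mulrCA weight_moment_rec mulrCA. Qed.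

End Semicircle.

Section Chebyshev.
Variable C : numClosedFieldType.

(** Second kind, rescaled to [-2, 2]: the value at 2 cos t is sin((k+1)t) / sin t. *)
Fixpoint cheb (k : nat) : {poly C} :=
  if k is k'.+1 then (if k' is k''.+1 then cheb k' * 'X - cheb k'' else 'X) else 1.

Lemma chebSS k : cheb k.+2 = cheb k.+1 * 'X - cheb k. Proof. by []. Qed.

Lemma deriv_cheb k :
  (4%:P - 'X^2) * (cheb k.+1)^`() =
  - (k.+1%:R * 'X * cheb k.+1) + (2 * k.+2)%:R * cheb k.
Proof.
suff : (4%:P - 'X^2) * (cheb k.+1)^`() =
  - (k.+1%:R * 'X * cheb k.+1) + (2 * k.+2)%:R * cheb k /\
  (4%:P - 'X^2) * (cheb k.+2)^`() =
  - (k.+2%:R * 'X * cheb k.+2) + (2 * k.+3)%:R * cheb k.+1 by case.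
elim: k => [|k [IH1 IH2]].
  split; first by rewrite /= derivX; ring.
  by rewrite /= derivB derivM derivX derivC; ring.
split => //; rewrite [cheb k.+3]chebSS derivB derivM derivX mulrBr mulrDr IH1.
rewrite mulrA IH2 !chebSS; ring.
Qed.

Variables (L : {poly C} -> C).
Hypothesis L_linear : scalar L.
Hypothesis L_moment : forall k, k.+3%:R * L ('X^(k.+1)) = 4 * k%:R * L ('X^(k.-1)).

Let L0 : L 0 = 0.
Proof. by have := L_linear (-1) 0 0; rewrite scaler0 addr0 mulN1r addNr. Qed.

Let LZ a (q : {poly C}) : L (a *: q) = a * L q.
Proof. by rewrite -[_ *: _]addr0 L_linear L0 addr0. Qed.

Let LB (p q : {poly C}) : L (p - q) = L p - L q.
Proof. by rewrite addrC -scaleN1r L_linear mulN1r addrC. Qed.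

Let LD (p q : {poly C}) : L (p + q) = L p + L q.
Proof. by rewrite -{1}[p]scale1r L_linear mul1r. Qed.

(** The moment recursion extended by linearity; for the semicircle law it integrates the derivative
    of q (4 - x^2)^(3/2). *)
Lemma moment_deriv (q : {poly C}) : L ((4%:P - 'X^2) * q^`() - 3 * 'X * q) = 0.
Proof.
rewrite -[q]coefK poly_def raddf_sum /= !mulr_sumr -sumrB (big_morph L LD L0).
apply: big1 => i _; rewrite derivZ -!scalerAr -scalerBr LZ.
suff -> : L ((4%:P - 'X^2) * ('X^i)^`() - 3 * 'X * 'X^i) = 0 by rewrite mulr0.
have -> : (4%:P - 'X^2) * ('X^i)^`() - 3 * 'X * 'X^i =
    (4 * i%:R) *: 'X^(i.-1) - i.+3%:R *: 'X^(i.+1) :> {poly C}.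
  rewrite derivXn -!mul_polyC !polyCM !polyC_natr.
  case: (val i) => [|j] /=; first by rewrite mulr0n expr0 !expr1; ring.
  by rewrite !exprS; ring.
by rewrite LB !LZ L_moment subrr.
Qed.

(** [moment_deriv] at [cheb j.+1] gives [rec] through [deriv_cheb]. Its right side vanishes at
    [j = 0], which starts the even indices; the odd ones start from the first moment. *)
Lemma cheb_centered k : L (cheb k.+1) = 0.
Proof.
have rec j : j.+4%:R * L (cheb j.+2) = j%:R * L (cheb j).
  have := moment_deriv (cheb j.+1); rewrite deriv_cheb.
  have -> : - (j.+1%:R * 'X * cheb j.+1) + (2 * j.+2)%:R * cheb j - 3 * 'X * cheb j.+1 =
      j%:R *: cheb j - j.+4%:R *: cheb j.+2.
    by rewrite -!mul_polyC !polyC_natr chebSS; ring.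
  by rewrite LB !LZ => /eqP; rewrite subr_eq0 => /eqP.
suff : L (cheb k.+1) = 0 /\ L (cheb k.+2) = 0 by case.
have nz j x : j.+1%:R * x = 0 :> C -> x = 0.
  by move=> /eqP; rewrite mulf_eq0 pnatr_eq0 => /eqP.
elim: k => [|k [IH1 IH2]].
  split; last by apply: (nz 3%N); rewrite rec mul0r.
  by apply: (nz 2%N); rewrite /= -['X]expr1 L_moment mulr0 mul0r.
by split=> //; apply: (nz k.+4); rewrite rec IH1 mulr0.
Qed.

End Chebyshev.
Arguments cheb : simpl never.

(** * Wick words in a free product *)

Section Subalgebra.
Variables (R : realType) (A : algType R[i]) (star : A -> A).

Lemma star_alg_subalgebra G : unital_star_subalgebra star (star_alg star G).
Proof.
split.
- by move=> B [hB _]; exact: (subalg_1 hB).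
- by move=> z x y hx hy B hB; apply: (subalg_lin hB.1); [exact: hx | exact: hy].
- by move=> x y hx hy B hB; apply: (subalg_mul hB.1); [exact: hx | exact: hy].
- by move=> x hx B hB; apply: (subalg_star hB.1); exact: hx.
Qed.

Lemma star_alg_gen (G : set A) x : G x -> star_alg star G x.
Proof. by move=> Gx B [_]; exact. Qed.

Variable S : set A.
Hypothesis hS : unital_star_subalgebra star S.

Lemma subalg0 : S 0.
Proof.
rewrite -(subrr (1 : A)) -scaleN1r addrC.
by apply: (subalg_lin hS); exact: (subalg_1 hS).
Qed.

Lemma subalgZ z x : S x -> S (z *: x).
Proof. by move=> Sx; rewrite -[_ *: _]addr0; apply: (subalg_lin hS) => //; exact: subalg0. Qed.

Lemma subalgD x y : S x -> S y -> S (x + y).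
Proof. by move=> Sx Sy; rewrite -[x]scale1r; exact: (subalg_lin hS). Qed.

Lemma subalgB x y : S x -> S y -> S (x - y).
Proof. by move=> Sx Sy; rewrite addrC -scaleN1r; exact: (subalg_lin hS). Qed.

Lemma subalg_cheb s k : S s -> S (horner_alg s (cheb R[i] k)).
Proof.
move=> Ss; suff : S (horner_alg s (cheb R[i] k)) /\ S (horner_alg s (cheb R[i] k.+1)) by case.
elim: k => [|k [IH1 IH2]].
  rewrite (_ : cheb _ 0 = 1) // (_ : cheb _ 1 = 'X) // rmorph1 horner_algX.
  by split => //; exact: (subalg_1 hS).
split => //; rewrite chebSS rmorphB rmorphM /= horner_algX.
by apply: subalgB => //; exact: (subalg_mul hS).
Qed.
End Subalgebra.

Section Words.
Variables (R : realType) (A : algType R[i]) (star : A -> A) (tau : {scalar A}).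
Local Notation C := R[i].

Lemma semicircular_cheb s k : semicircular star tau s ->
  tau (horner_alg s (cheb C k.+1)) = 0.
Proof.
move=> [_ hs].
apply: (@cheb_centered C (fun p => tau (horner_alg s p)) _ _ k) => [a p q|j].
  by rewrite rmorphD /= -mul_polyC rmorphM /= horner_algC mulr_algl linearP.
rewrite !rmorphXn /= horner_algX !hs.
have := congr1 (@real_complex R) (semicircle_moment_rec R j).
by rewrite !rmorphM /= !rmorph_nat.
Qed.

Definition wprod (w : seq (bool * A)) : A := \prod_(x <- w) x.2.

Lemma wprod_rcons w x : wprod (rcons w x) = wprod w * x.2.
Proof. by rewrite /wprod -cats1 big_cat big_seq1. Qed.

Lemma wprod_cons x w : wprod (x :: w) = x.2 * wprod w.
Proof. by rewrite /wprod big_cons. Qed.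

Lemma wprod_cat w1 w2 : wprod (w1 ++ w2) = wprod w1 * wprod w2.
Proof. by rewrite /wprod big_cat. Qed.

Definition alternating : rel (bool * A) := [rel x y | x.1 != y.1].

Lemma sorted_rcons_alt w b x :
  sorted alternating w -> (if w is [::] then True else (last (b, 0) w).1 != b) ->
  sorted alternating (rcons w (b, x)).
Proof.
case: w => [|y w] //= hw hl; rewrite rcons_path hw.
by move: hl => /=; case: w {hw} => [|z w].
Qed.

Variables s1 s2 : A.
Hypotheses (sc1 : semicircular star tau s1) (sc2 : semicircular star tau s2).
Hypothesis fr : star_free star tau [set s1] [set s2].

Definition sgen (t : bool) : A := if t then s1 else s2.

(** The last letter is the head of the list. Only neighbours of equal type are contracted, since
    free semicirculars have covariance 0. *)
Fixpoint wick (l : seq bool) : A :=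
  if l is t :: l1 then
    wick l1 * sgen t - (if l1 is t' :: l2 then if t' == t then wick l2 else 0 else 0)
  else 1.

Let S b := if b then star_alg star [set s1] else star_alg star [set s2].

Lemma S_subalg b : unital_star_subalgebra star (S b).
Proof. by case: b; exact: star_alg_subalgebra. Qed.

Lemma S_gen b : S b (sgen b).
Proof. by case: b; exact: star_alg_gen. Qed.

Definition centered_word (w : seq (bool * A)) :=
  sorted alternating w /\ forall x, x \in w -> S x.1 x.2 /\ tau x.2 = 0.

Lemma centered_cheb b k : tau (horner_alg (sgen b) (cheb C k.+1)) = 0.
Proof. by case: b; exact: semicircular_cheb. Qed.

(** A run of equal letters obeys the Chebyshev recursion: [k] is the number of [t] at the head of
    [l], and [w] holds the other runs as centered polynomials. *)
Lemma wick_cheb t l : exists k w,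
  [/\ centered_word w, (if w is [::] then True else (last (t, 0) w).1 != t),
      wick (t :: l) = wprod w * horner_alg (sgen t) (cheb C k.+1) &
      wick l = wprod w * horner_alg (sgen t) (cheb C k)].
Proof.
elim: l t => [|t' l IH] t.
  exists 0%N, [::]; rewrite /wprod big_nil !mul1r; split => //.
    by rewrite [LHS]/= mul1r subr0 (_ : cheb C 1 = 'X) // horner_algX.
  by rewrite (_ : cheb C 0 = 1) // rmorph1.
have [k [w [[ws wc] wl e1 e2]]] := IH t'.
have [tt|tt] := eqVneq t' t.
  exists k.+1, w; split=> //; rewrite -?tt //.
  rewrite [LHS]/= eqxx -/(wick (t' :: l)) e1 e2 chebSS rmorphB rmorphM /= horner_algX.
  by rewrite mulrBr mulrA.
exists 0%N, (rcons w (t', horner_alg (sgen t') (cheb C k.+1))); split.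
- split; first exact: sorted_rcons_alt.
  move=> x; rewrite mem_rcons inE => /orP[/eqP ->|] /=; last exact: wc.
  split; last exact: centered_cheb.
  by apply: (subalg_cheb (S_subalg t')); exact: S_gen.
- by case: w {ws wc wl e1 e2} => [|y w] /=; rewrite ?last_rcons.
- rewrite [LHS]/= (negbTE tt) subr0 -/(wick (t' :: l)) e1 wprod_rcons /=.
  by rewrite (_ : cheb C 1 = 'X) // horner_algX.
- by rewrite e1 wprod_rcons /= (_ : cheb C 0 = 1) // rmorph1 mulr1.
Qed.

Lemma wick_centered t l : tau (wick (t :: l)) = 0.
Proof.
have [k [w [[ws wc] wl -> _]]] := wick_cheb t l.
rewrite -[X in _ * X]/((t, horner_alg (sgen t) (cheb C k.+1)).2) -wprod_rcons.
apply: fr => [|x|]; first by rewrite -size_eq0 size_rcons.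
  rewrite mem_rcons inE => /orP[/eqP ->|] /=; last by move/wc; rewrite /S.
  split; last exact: centered_cheb.
  by apply: (subalg_cheb (S_subalg t)); exact: S_gen.
exact: sorted_rcons_alt.
Qed.

Lemma wick_subalg (D : set A) l : unital_star_subalgebra star D ->
  D s1 -> D s2 -> D (wick l).
Proof.
move=> hD D1 D2; have Ds t : D (sgen t) by case: t.
suff : D (wick l) /\ D (if l is t :: l' then wick l' else 1) by case.
elim: l => [|t l [IH1 IH2]]; first by split; exact: (subalg_1 hD).
split => //=; apply: (subalgB hD); first exact: (subalg_mul hD).
by case: l IH1 IH2 => [|t' l] _ IH2; [|case: eqP => _ //]; exact: (subalg0 hD).
Qed.
End Words.

Lemma wprod_nil (R : realType) (A : algType R[i]) : wprod [::] = 1 :> A.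
Proof. by rewrite /wprod big_nil. Qed.

(** * Wick words interlaced with matrices *)

Section MatrixWick.
Variables (R : realType) (A : algType R[i]) (star : A -> A) (tau : {scalar A}).
Local Notation C := R[i].
Variables (n : nat) (iota : {rmorphism 'M[C]_n -> A}) (s1 s2 : A) (D : set A).
Hypothesis tau1 : tau 1 = 1.
Hypothesis tauC : forall x y, tau (x * y) = tau (y * x).
Hypothesis iotaZ : scalable iota.
Hypotheses (sc1 : semicircular star tau s1) (sc2 : semicircular star tau s2).
Hypothesis fr12 : star_free star tau [set s1] [set s2].
Hypothesis hD : unital_star_subalgebra star D.
Hypotheses (D1 : D s1) (D2 : D s2).
Hypothesis fr : free_family tau (fun b : bool =>
  if b then star_alg star (range iota) else D).

Local Notation tr M := (tau (iota M)).
Local Notation sgen := (sgen s1 s2).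
Local Notation wick := (wick s1 s2).

Fixpoint mwick (N0 : 'M[C]_n) (l : seq (bool * 'M[C]_n)) : A :=
  if l is (t, N) :: l1 then
    mwick N0 l1 * sgen t * iota N -
    (if l1 is (t', N') :: l2 then
       if t' == t then tr N' *: (mwick N0 l2 * iota N) else 0
     else 0)
  else iota N0.

Definition ctrd (N : 'M[C]_n) : 'M[C]_n := N - (tr N)%:M.

Lemma iota_ctrd N : iota N = iota (ctrd N) + (tr N)%:A.
Proof.
by rewrite /ctrd rmorphB -[(tr N)%:M]scalemx1 iotaZ rmorph1 subrK.
Qed.

Lemma tr_ctrd N : tr (ctrd N) = 0.
Proof.
have := congr1 tau (iota_ctrd N); rewrite linearD linearZ /= tau1 mulr1.
by move=> h; apply: (addIr (tr N)); rewrite add0r -h.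
Qed.

(* Alternating products [d_1 b_1 ... d_r b_r] with [d_i] in [D] and [b_i] in the
   image of [iota], all centered. *)
Definition pairs (ps : seq (A * A)) : seq (bool * A) :=
  flatten [seq [:: (false, z.1); (true, z.2)] | z <- ps].

Definition good_pairs (ps : seq (A * A)) : Prop := forall z, z \in ps ->
  [/\ D z.1, star_alg star (range iota) z.2, tau z.1 = 0 & tau z.2 = 0].

Lemma pairs_rcons ps z :
  pairs (rcons ps z) = pairs ps ++ [:: (false, z.1); (true, z.2)].
Proof. by rewrite /pairs map_rcons flatten_rcons. Qed.

Lemma path_pairs ps x d : path (alternating (A := A)) (true, x)
  (pairs ps ++ [:: (false, d)]).
Proof. by elim: ps x => [|z ps IH] x //=; rewrite IH. Qed.

Lemma good_pairsP ps d : good_pairs ps -> D d -> tau d = 0 ->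
  forall x, x \in pairs ps ++ [:: (false, d)] ->
    (if x.1 then star_alg star (range iota) else D) x.2 /\ tau x.2 = 0.
Proof.
move=> gp Dd d0 x; rewrite mem_cat => /orP[/flattenP[_ /mapP[z zs ->]]|].
  by have [? ? ? ?] := gp _ zs; rewrite !inE => /orP[] /eqP ->.
by rewrite inE => /eqP ->.
Qed.

(** The centered part of [iota N] extends the alternating word, its scalar part leaves the word
    alternating; freeness kills both. *)
Lemma tau_alternating N ps d : good_pairs ps -> D d -> tau d = 0 ->
  tau (iota N * wprod (pairs ps) * d) = 0.
Proof.
move=> gp Dd d0; have gd := good_pairsP gp Dd d0.
have e : wprod (pairs ps) * d = wprod (pairs ps ++ [:: (false, d)]).
  by rewrite wprod_cat /wprod big_seq1.
rewrite -mulrA e iota_ctrd mulrDl mulr_algl linearD linearZ /=.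
have -> : tau (wprod (pairs ps ++ [:: (false, d)])) = 0.
  apply: fr => //; first by case: (pairs ps).
  exact: path_sorted (path_pairs ps 0 d).
rewrite mulr0 addr0.
have -> : iota (ctrd N) = (true, iota (ctrd N)).2 by [].
rewrite -wprod_cons; apply: fr => // [x|]; last exact: path_pairs.
rewrite inE => /orP[/eqP ->|] /=; last exact: gd.
by split; [apply: star_alg_gen; exists (ctrd N) | exact: tr_ctrd].
Qed.

Local Notation term := ('M[C]_n * seq (A * A) * seq bool)%type.

(** Each inner matrix splits into a centered part, which seals the current Wick word into a pair,
    and a scalar, across which the word goes on; there the contraction is that of [wick], with the
    same trace as weight. Both equations share [J] because a contraction steps back by two
    letters. *)
Lemma mwick_decomp N0 t l : exists J : seq term,
  [/\ forall j, j \in J -> good_pairs j.1.2,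
    mwick N0 l * sgen t -
      (if l is (t', N') :: l2 then if t' == t then tr N' *: mwick N0 l2 else 0 else 0) =
    \sum_(j <- J) iota j.1.1 * wprod (pairs j.1.2) * wick (t :: j.2) &
    mwick N0 l = \sum_(j <- J) iota j.1.1 * wprod (pairs j.1.2) * wick j.2].
Proof.
elim: l t => [|[t' N'] l IH] t.
  exists [:: (N0, [::], [::])]; rewrite !big_seq1 /wprod big_nil /= !mulr1 mul1r !subr0.
  by split => // j; rewrite inE => /eqP ->.
have [J [gJ e1 e2]] := IH t'.
have e3 : mwick N0 ((t', N') :: l) =
    (\sum_(j <- J) iota j.1.1 * wprod (pairs j.1.2) * wick (t' :: j.2)) * iota N'.
  rewrite -e1 [LHS]/= mulrBl; congr (_ - _).
  by case: (l) => [|[t'' N''] l2]; rewrite ?mul0r //; case: eqP; rewrite ?mul0r // scalerAl.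
pose J1 := [seq (j.1.1, rcons j.1.2 (wick (t' :: j.2), iota (ctrd N')), [::]) | j <- J] : seq term.
pose J2 := [seq (tr N' *: j.1.1, j.1.2, t' :: j.2) | j <- J] : seq term.
have e4 : mwick N0 ((t', N') :: l) = \sum_(j <- J1 ++ J2) iota j.1.1 * wprod (pairs j.1.2) * wick j.2.
  rewrite e3 big_cat /= !big_map mulr_suml -big_split /=; apply: eq_bigr => j _.
  rewrite pairs_rcons wprod_cat !wprod_cons wprod_nil !mulr1 /=.
  by rewrite {1}(iota_ctrd N') mulrDr mulr_algr !mulrA iotaZ -!scalerAl.
exists (J1 ++ J2); split => //.
  move=> j; rewrite mem_cat => /orP[] /mapP[i iJ ->] /=; last exact: gJ.
  move=> z; rewrite mem_rcons inE => /orP[/eqP ->|] /=; last exact: gJ.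
  split; [exact: (wick_subalg (t' :: i.2) hD D1 D2) | by apply: star_alg_gen; exists (ctrd N') |
          exact: (wick_centered sc1 sc2 fr12 t' i.2) | exact: tr_ctrd].
rewrite e4 big_cat [in RHS]big_cat /= mulrDl !big_map -addrA; congr (_ + _).
  rewrite mulr_suml; apply: eq_bigr => j _.
  by rewrite /= mulr1 subr0 mul1r.
transitivity (\sum_(j <- J) tr N' *: (iota j.1.1 * wprod (pairs j.1.2) *
     (wick (t' :: j.2) * sgen t - (if t' == t then wick j.2 else 0)))).
  rewrite -scaler_sumr; under [in RHS]eq_bigr do rewrite mulrBr.
  rewrite sumrB scalerBr; congr (_ - _).
    rewrite mulr_suml scaler_sumr; apply: eq_bigr => j _.
    by rewrite iotaZ -!scalerAl !mulrA.
  case: eqP => _; last by rewrite big1 ?scaler0 // => j _; rewrite mulr0.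
  by rewrite e2.
by apply: eq_bigr => j _; rewrite /= iotaZ -!scalerAl.
Qed.

(** Traciality brings the last matrix to the front, where it merges with the first one. *)
Lemma tau_mwick N0 t N l : tau (mwick N0 ((t, N) :: l)) = 0.
Proof.
have [J [gJ e1 _]] := mwick_decomp N0 t l.
have -> : mwick N0 ((t, N) :: l) =
    (\sum_(j <- J) iota j.1.1 * wprod (pairs j.1.2) * wick (t :: j.2)) * iota N.
  rewrite -e1 [LHS]/= mulrBl; congr (_ - _).
  by case: (l) => [|[t'' N''] l2]; rewrite ?mul0r //; case: eqP; rewrite ?mul0r // scalerAl.
rewrite mulr_suml raddf_sum big_seq big1 // => j jJ.
rewrite /= tauC !mulrA -rmorphM; apply: tau_alternating; first exact: gJ.
  exact: (wick_subalg (t :: j.2) hD D1 D2).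
exact: (wick_centered sc1 sc2 fr12 t j.2).
Qed.
End MatrixWick.

(** * Operator-valued Wick words of the circular element *)

Section FreeSide.
Variables (R : realType) (A : algType R[i]) (star : A -> A) (tau : {scalar A}).
Local Notation C := R[i].
Variables (n p : nat) (iota : {rmorphism 'M[C]_n -> A}) (c : A).
Hypothesis hc : circular_free_product star tau iota c.
Local Notation M := 'M['M[C]_n]_p.
Local Notation sqrt2V := (((Num.sqrt 2)^-1)%:C%C : C).

Lemma sqrt2V2 : 2 * (sqrt2V * sqrt2V) = 1.
Proof.
rewrite -rmorphM /= -invfM -expr2 sqr_sqrtr ?ler0n //.
rewrite (_ : (2 : C) = (2 : R)%:C%C); last by rewrite rmorph_nat.
by rewrite -rmorphM /= divff ?rmorph1 // pnatr_eq0.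
Qed.

Definition xlet (e : bool) : A := if e then c else star c.

Lemma starD x y : star (x + y) = star x + star y.
Proof. by have := star_antilinear (cfp_space hc) 1 x y; rewrite !scale1r rmorph1 scale1r. Qed.

Lemma star0 : star 0 = 0.
Proof. by apply: (addrI (star 0)); rewrite -starD !addr0. Qed.

Lemma starZ z x : star (z *: x) = z^* *: star x.
Proof. by rewrite -[z *: x]addr0 (star_antilinear (cfp_space hc)) star0 addr0. Qed.

(** [s1] and [s2] are recovered from [c] and its adjoint, so they lie in the algebra that is free
    from the matrices. *)
Lemma circular_letters : exists s1 s2,
  [/\ semicircular star tau s1, semicircular star tau s2,
      star_free star tau [set s1] [set s2],
      star_alg star [set c] s1 /\ star_alg star [set c] s2 &
      forall e, xlet e = \sum_t (kap C e t * sqrt2V) *: sgen s1 s2 t].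
Proof.
have [s1 [s2 [h1 h2 h3 hcs]]] := cfp_circular hc.
have hS := star_alg_subalgebra star [set c].
have ec : xlet true = \sum_t (kap C true t * sqrt2V) *: sgen s1 s2 t.
  by rewrite /xlet hcs big_bool /= mul1r scalerDr scalerA complexiE [sqrt2V * _]mulrC.
have ecs : xlet false = \sum_t (kap C false t * sqrt2V) *: sgen s1 s2 t.
  rewrite /xlet hcs big_bool /= mul1r starZ starD starZ h1.1 h2.1.
  have -> : sqrt2V^* = sqrt2V by exact: conjc_real.
  by rewrite complexiE conjCi scalerDr scalerA [sqrt2V * _]mulrC.
have cc : star_alg star [set c] c by exact: star_alg_gen.
have cs : star_alg star [set c] (star c) by exact: (subalg_star hS).
exists s1, s2; split => //; last by case.
have e1 : s1 = sqrt2V *: (xlet true + xlet false).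
  rewrite ec ecs !big_bool /= mulNr !scaleNr addrACA subrr addr0.
  by rewrite mul1r -mulr2n -[(_ *: s1) *+ 2]scaler_nat !scalerA mulrCA sqrt2V2 scale1r.
have e2 : s2 = (- 'i * sqrt2V) *: (xlet true - xlet false).
  rewrite ec ecs !big_bool /= !mul1r opprD addrACA subrr add0r -scaleNr -scalerDl.
  rewrite scalerA -[LHS]scale1r; congr (_ *: _).
  rewrite -[LHS]sqrt2V2.
  transitivity (- 'i ^+ 2 * (2 * (sqrt2V * sqrt2V))); last by ring.
  by rewrite sqrCi; ring.
rewrite e1 e2; split; apply: (subalgZ hS).
  exact: (subalgD hS).
exact: (subalgB hS).
Qed.

Local Notation iN := (map_mx iota).

Fixpoint ww (N0 : M) (st : seq (bool * M)) : 'M[A]_p :=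
  if st is (e, N) :: st1 then
    ww N0 st1 *m (xlet e)%:M *m iN N -
    (if st1 is (e', N') :: st2 then
       if e' == e then 0 else ww N0 st2 *m iN (scal (ptr N') *m N)
     else 0)
  else iN N0.

Fixpoint word (s : seq (bool * M)) : 'M[A]_p :=
  if s is (e, N) :: s1 then (xlet e)%:M *m iN N *m word s1 else 1%:M.

(** A Wick word for the letters read, a plain word for the rest: [FF_step] is then the definition of
    [ww] solved for the plain product. *)
Definition FF (z : M * seq (bool * M)) (s : seq (bool * M)) : 'M[C]_p :=
  map_mx tau (ww z.1 z.2 *m word s).

Lemma ww_mtop z K : ww (mtop z K).1 (mtop z K).2 = ww z.1 z.2 *m iN K.
Proof.
case: z => N0 [|[e N] st] /=; first by rewrite map_mxM.
rewrite map_mxM mulmxA mulmxBl; congr (_ - _).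
case: st => [|[e' N'] st]; rewrite ?mul0mx //; case: eqP => _; rewrite ?mul0mx //.
by rewrite !map_mxM !mulmxA.
Qed.

Lemma map_tauB (X Y : 'M[A]_p) : map_mx tau (X - Y) = map_mx tau X - map_mx tau Y.
Proof. by apply/matrixP => k l; rewrite !mxE raddfB. Qed.

Lemma FF_step N0 st e N s :
  FF (N0, st) ((e, N) :: s) = FF (N0, (e, N) :: st) s +
  (if st is (e1, N1) :: st1 then
     (if e1 == e then 0 else FF (mtop (N0, st1) (scal (ptr N1) *m N)) s)
   else 0).
Proof.
rewrite /FF [in RHS]/= mulmxBl map_tauB !mulmxA -addrA -[LHS]addr0; congr (_ + _).
case: st => [|[e1 N1] st1]; first by rewrite mul0mx map_mx0 addr0 oppr0.
case: eqP => _; first by rewrite mul0mx map_mx0 addr0 oppr0.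
by rewrite ww_mtop /= addrC subrr.
Qed.

Lemma tau_iota (N : M) : map_mx tau (iN N) = ptr N.
Proof. by apply/matrixP => k l; rewrite !mxE (cfp_tr hc). Qed.

Section Expansion.
Variables s1 s2 : A.
Hypotheses (sc1 : semicircular star tau s1) (sc2 : semicircular star tau s2).
Hypothesis fr12 : star_free star tau [set s1] [set s2].
Hypotheses (D1 : star_alg star [set c] s1) (D2 : star_alg star [set c] s2).
Hypothesis xletE : forall e, xlet e = \sum_t (kap C e t * sqrt2V) *: sgen s1 s2 t.

Local Notation coef e t := (kap C e t * sqrt2V).
Local Notation slist := (seq (bool * 'M[C]_n)).
Local Notation mw := (mwick tau iota s1 s2).

(* Entry [(k, l)] of a word, expanded along all paths of matrix indices and over
   the semicircular components of its letters. *)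
Fixpoint psum (st : seq (bool * M)) (N0 : M) k l (f : 'M[C]_n -> slist -> A) : A :=
  if st is (e, N) :: st' then
    \sum_q \sum_t psum st' N0 k q (fun B L => f B ((t, coef e t *: N q l) :: L))
  else f (N0 k l) [::].

Lemma eq_psum st N0 k l f g :
  (forall B L, f B L = g B L) -> psum st N0 k l f = psum st N0 k l g.
Proof.
elim: st l f g => [|[e N] st IH] l f g fg //=.
by apply: eq_bigr => q _; apply: eq_bigr => t _; apply: IH => B L.
Qed.

Lemma psumM st N0 k l f x :
  psum st N0 k l (fun B L => f B L * x) = psum st N0 k l f * x.
Proof.
elim: st l f => [|[e N] st IH] l f //=.
rewrite mulr_suml; apply: eq_bigr => q _; rewrite mulr_suml; apply: eq_bigr => t _.
exact: (IH _ (fun B L => f B ((t, coef e t *: N q l) :: L))).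
Qed.

Lemma psumB st N0 k l f g :
  psum st N0 k l (fun B L => f B L - g B L) = psum st N0 k l f - psum st N0 k l g.
Proof.
elim: st l f g => [|[e N] st IH] l f g //=.
rewrite -sumrB; apply: eq_bigr => q _; rewrite -sumrB; apply: eq_bigr => t _.
exact: (IH _ (fun B L => f B ((t, coef e t *: N q l) :: L))
             (fun B L => g B ((t, coef e t *: N q l) :: L))).
Qed.

Lemma psum0 st N0 k l : psum st N0 k l (fun _ _ => 0) = 0.
Proof.
elim: st l => [|[e N] st IH] l //=.
by rewrite big1 // => q _; rewrite big1 // => t _; exact: IH.
Qed.

Lemma psumZ st N0 k l f z :
  psum st N0 k l (fun B L => z *: f B L) = z *: psum st N0 k l f.
Proof.
elim: st l f => [|[e N] st IH] l f //=.
rewrite scaler_sumr; apply: eq_bigr => q _; rewrite scaler_sumr; apply: eq_bigr => t _.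
exact: (IH _ (fun B L => f B ((t, coef e t *: N q l) :: L))).
Qed.

Lemma tau_psum st N0 k l f : (forall B L, size L = size st -> tau (f B L) = 0) ->
  tau (psum st N0 k l f) = 0.
Proof.
elim: st l f => [|[e N] st IH] l f h /=; first exact: h.
rewrite raddf_sum big1 // => q _; rewrite raddf_sum big1 // => t _.
by apply: IH => B L sL; apply: h; rewrite /= sL.
Qed.

Lemma tau_iotaZ z N : tau (iota (z *: N)) = z * tau (iota N).
Proof. by rewrite (cfp_scalable hc) linearZ. Qed.

Lemma sum_coef e e' : \sum_t coef e t * coef e' t = (e != e')%:R.
Proof.
transitivity ((\sum_t kap C e t * kap C e' t) * (sqrt2V * sqrt2V)).
  by rewrite mulr_suml; apply: eq_bigr => t _; ring.
rewrite sum_kap; case: eqP => _; rewrite ?mul0r //=; exact: sqrt2V2.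
Qed.

(** By [sum_coef] the covariance of two circular letters is the sum of those of their components, so
    the contractions of [ww] and [mwick] agree entrywise. The clause on [behead st] serves the
    recursion of depth two. *)
Lemma ww_psum st N0 k l : ww N0 st k l = psum st N0 k l mw.
Proof.
suff : (forall l, ww N0 st k l = psum st N0 k l mw) /\
       (forall l, ww N0 (behead st) k l = psum (behead st) N0 k l mw) by case.
elim: st {l} => [|[e N] st [IH1 IH2]]; first by split=> l; rewrite /= mxE.
split=> // l; rewrite [LHS]/= [in RHS]/= mxE.
have T1 : (ww N0 st *m (xlet e)%:M *m iN N) k l =
   \sum_q \sum_t psum st N0 k q mw * sgen s1 s2 t * iota (coef e t *: N q l).
  rewrite mxE; apply: eq_bigr => q _.
  have -> : (ww N0 st *m (xlet e)%:M) k q = ww N0 st k q * xlet e.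
    rewrite mxE (bigD1 q) //= [X in _ + X]big1 ?addr0 => [|j jq]; rewrite mxE ?eqxx //.
    by rewrite (negbTE jq) mulr0n mulr0.
  rewrite IH1 xletE mulr_sumr mulr_suml; apply: eq_bigr => t _.
  by rewrite mxE (cfp_scalable hc) -scalerAr -scalerAl -scalerAr.
rewrite T1 [X in _ + X]mxE.
(* The contraction term of [mwick] when [(t, coef e t *: N q l)] is put on top of [L]. *)
pose g e N (q : 'I_p) (l : 'I_p) t (B : 'M[C]_n) (L : slist) : A :=
   if L is (t', N') :: l2 then if t' == t
     then tau (iota N') *: (mw B l2 * iota (coef e t *: (N : M) q l)) else 0 else 0.
transitivity (\sum_q \sum_t (psum st N0 k q mw * sgen s1 s2 t * iota (coef e t *: N q l)
   - psum st N0 k q (g e N q l t))); last first.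
  apply: eq_bigr => q _; apply: eq_bigr => t _.
  by rewrite -!psumM -psumB; apply: eq_psum => B [|[t' N'] L].
under [in RHS]eq_bigr do rewrite sumrB.
rewrite sumrB; congr (_ - _).
case: st IH1 IH2 T1 => [|[e' N'] st2] IH1 IH2 T1.
  by rewrite mxE big1 // => q _; rewrite big1.
transitivity (\sum_q \sum_q' ((e' != e)%:R * tau (iota (N' q' q))) *:
   (psum st2 N0 k q' mw * iota (N q l))); last first.
  apply: eq_bigr => q _ /=; rewrite exchange_big; apply: eq_bigr => q' _ /=.
  rewrite exchange_big /= -sum_coef mulr_suml scaler_suml; apply: eq_bigr => t' _.
  rewrite (bigD1 t') //= [X in _ + X]big1 ?addr0 => [|t tt].
    rewrite eqxx psumZ psumM tau_iotaZ (cfp_scalable hc) -scalerAr scalerA.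
    by congr (_ *: _); ring.
  by rewrite eq_sym (negbTE tt) psum0.
have [ee|ee] := eqVneq e' e.
  by rewrite mxE big1 // => q _; rewrite big1 // => q' _; rewrite mul0r scale0r.
rewrite mxE exchange_big; apply: eq_bigr => q' _ /=.
rewrite -IH2 /= [in LHS]mxE mxE raddf_sum mulr_sumr; apply: eq_bigr => q _ /=.
rewrite rmorphM !mxE -scalemx1 (cfp_scalable hc) rmorph1 mul1r.
by rewrite -scalerAl mul1r -scalerAr (cfp_tr hc).
Qed.
End Expansion.

Lemma FF_nil N0 st : FF (N0, st) [::] = if st is [::] then ptr N0 else 0.
Proof.
rewrite /FF /= mulmx1; case: st => [|[e N] st]; first exact: tau_iota.
have [s1 [s2 [sc1 sc2 fr12 [D1 D2] xE]]] := circular_letters.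
apply/matrixP => k l; rewrite [LHS]mxE [RHS]mxE (ww_psum xE).
apply: tau_psum => B [//|[t N'] L] _.
apply: (tau_mwick _ _ _ sc1 sc2 fr12 _ D1 D2) => //.
- exact: (tau1 (cfp_space hc)).
- exact: (tau_tracial (cfp_space hc)).
- exact: (cfp_scalable hc).
- exact: star_alg_subalgebra.
- exact: (cfp_free hc).
Qed.
End FreeSide.

Import numFieldNormedType.Exports.

(** * Gaussian moments *)

Section Disintegration.
Local Open Scope classical_set_scope.
Local Open Scope ereal_scope.
Context {R : realType} {d d' : measure_display} {T : measurableType d} {U : measurableType d'}.
Variables (P : {measure set T -> \bar R}) (Y : T -> U) (G : T -> R).
Variables (nu : {measure set U -> \bar R}) (kappa : R).
Hypotheses (mY : measurable_fun setT Y) (mG : measurable_fun setT G).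
Hypotheses (G0 : forall w, (0 <= G w)%R) (kappa0 : (0 <= kappa)%R).
Hypothesis indic_case : forall E, measurable E ->
  \int[P]_w (\1_E (Y w) * G w)%:E = kappa%:E * nu E.

Import HBNNSimple.

Lemma nnsfun_case (h : {nnsfun U >-> R}) :
  \int[P]_w (h (Y w) * G w)%:E = kappa%:E * \int[nu]_x (h x)%:E.
Proof.
have hE x : h x = (\sum_(r \in range h) r * \1_(h @^-1` [set r]) x)%R := fimfunE h x.
have mc r : measurable_fun setT (fun w => (r * \1_(h @^-1` [set r]) (Y w))%R).
  by apply: measurable_funM => //; apply: measurableT_comp.
transitivity (\int[P]_w \sum_(r \in range h)
   (r * \1_(h @^-1` [set r]) (Y w) * G w)%:E).
  apply: eq_integral => w _; rewrite hE EFinM -fsumEFin // ge0_mule_fsuml //.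
  by move=> r; exact: nnfun_muleindic_ge0.
rewrite ge0_integral_fsum //; last 2 first.
  - by move=> r; apply/measurable_EFinP; exact: measurable_funM.
  - move=> r w _; rewrite EFinM mule_ge0 ?lee_fin //.
    by have := nnfun_muleindic_ge0 h r (Y w); rewrite -EFinM lee_fin.
transitivity (kappa%:E * \int[nu]_x \sum_(r \in range h)
   (r * \1_(h @^-1` [set r]) x)%:E); last first.
  by congr (_ * _); apply: eq_integral => x _; rewrite hE -fsumEFin.
rewrite ge0_integral_fsum //; last 2 first.
  - by move=> r; apply/measurable_EFinP; exact: measurable_funM.
  - by move=> r x _; rewrite EFinM nnfun_muleindic_ge0.
rewrite ge0_mule_fsumr; last first.
  by move=> r; apply: integral_ge0 => x _; rewrite EFinM nnfun_muleindic_ge0.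
apply: eq_fsbigr => r rh.
have r0 : (0 <= r)%R by move: rh; rewrite inE => -[x _ <-].
under eq_integral do rewrite -mulrA EFinM.
rewrite ge0_integralZl //; last 2 first.
  - apply/measurable_EFinP; apply: measurable_funM => //.
    exact: measurableT_comp.
  - by move=> w _; rewrite lee_fin mulr_ge0.
rewrite indic_case //.
under [in RHS]eq_integral do rewrite EFinM.
rewrite [in RHS]ge0_integralZl //=; last exact/measurable_EFinP/measurable_indic.
by rewrite integral_indic // setIT muleCA.
Qed.

(** From indicators to nonnegative functions by monotone convergence. [G] will be a density, or the
    product of the factors in the other variables. *)
Lemma ge0_integral_indep (f : U -> R) : measurable_fun setT f -> (forall x, (0 <= f x)%R) ->
  \int[P]_w (f (Y w) * G w)%:E = kappa%:E * \int[nu]_x (f x)%:E.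
Proof.
move=> mf f0.
have mf' : measurable_fun setT (EFin \o f) by exact/measurable_EFinP.
pose f_ := nnsfun_approx measurableT mf'.
have cf x : (f_ n x)%:E @[n --> \oo] --> (f x)%:E.
  by apply: (cvg_nnsfun_approx measurableT mf') => // y _; rewrite /= lee_fin.
have -> : \int[nu]_x (f x)%:E = lim (\int[nu]_x (f_ n x)%:E @[n --> \oo]).
  rewrite -monotone_convergence //=.
  - apply: eq_integral => x _; apply/esym/cvg_lim => //; exact: cf.
  - by move=> n; exact/measurable_EFinP/measurable_funTS.
  - by move=> n x _; rewrite lee_fin.
  - by move=> x _ a b ab; rewrite lee_fin; exact/lefP/nd_nnsfun_approx.
have cg : (\int[nu]_x (f_ n x)%:E @[n --> \oo]) --> lim (\int[nu]_x (f_ n x)%:E @[n --> \oo]).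
  apply: ereal_nondecreasing_is_cvgn => a b ab.
  apply: ge0_le_integral => //.
  - by move=> x _; rewrite lee_fin.
  - by apply/measurable_EFinP.
  - by apply/measurable_EFinP.
  - by move=> x _; rewrite lee_fin; exact/lefP/nd_nnsfun_approx.
transitivity (lim (\int[P]_w (f_ n (Y w) * G w)%:E @[n --> \oo])).
  rewrite -monotone_convergence //=.
  - apply: eq_integral => w _; apply/esym/cvg_lim => //.
    by under eq_fun do rewrite EFinM; rewrite EFinM; apply: cvgeZr.
  - move=> n; apply/measurable_EFinP; apply: measurable_funM => //.
    exact: measurableT_comp.
  - by move=> n x _; rewrite lee_fin mulr_ge0.
  - move=> x _ a b ab; rewrite lee_fin ler_wpM2r //; exact/lefP/nd_nnsfun_approx.
under eq_fun do rewrite nnsfun_case.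
by apply/cvg_lim => //; apply: cvgeZl.
Qed.
End Disintegration.

Section GaussianMoments.
Local Open Scope classical_set_scope.
Variables (R : realType) (s : R).
Hypothesis s_gt0 : 0 < s.
Local Notation mu := (@lebesgue_measure R).
Local Notation nu := (normal_prob 0 s).
Local Notation pdf := (normal_pdf 0 s).

Let s0 : s != 0. Proof. by rewrite gt_eqF. Qed.

(** One term of the exponential series dominates x^(2k+2), and |x|^k <= 1 + x^(2k+2). *)
Lemma exprn_le_expR (c : R) k : 0 < c ->
  exists2 D : R, 0 <= D & forall x, `|x| ^+ k <= D * expR (c * x ^+ 2).
Proof.
move=> c0; pose F : R := (k.+1)`!%:R.
have F0 : 0 < F by rewrite ltr0n fact_gt0.
exists (1 + F / c ^+ k.+1) => [|x].
  by rewrite addr_ge0 ?divr_ge0 ?exprn_ge0 ?(ltW F0) ?(ltW c0).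
have y0 : 0 <= c * x ^+ 2 by rewrite mulr_ge0 ?sqr_ge0 // ltW.
have h1 : 1 <= expR (c * x ^+ 2) by rewrite -expR0 ler_expR.
have h2 := expR_ge1Dxn k y0; rewrite -/F in h2.
have h3 : x ^+ 2 ^+ k.+1 <= F / c ^+ k.+1 * expR (c * x ^+ 2).
  have ck : 0 < c ^+ k.+1 by rewrite exprn_gt0.
  rewrite mulrAC ler_pdivlMr // -exprMn [x ^+ 2 * c]mulrC.
  have : (c * x ^+ 2) ^+ k.+1 / F <= expR (c * x ^+ 2).
    by apply: le_trans h2; rewrite lerDr ler01.
  by rewrite ler_pdivrMr // [_ * F]mulrC.
apply: (@le_trans _ _ (1 + x ^+ 2 ^+ k.+1)); last by rewrite mulrDl mul1r lerD.
rewrite -[x ^+ 2]real_normK ?num_real // -exprM.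
have [x1|x1] := leP `|x| 1.
  by apply: (@le_trans _ _ 1); rewrite ?exprn_ile1 // lerDl exprn_ge0.
apply: (@le_trans _ _ (`|x| ^+ (2 * k.+1))); last by rewrite lerDr ler01.
by rewrite ler_eXn2l //; lia.
Qed.

Lemma pdfE x : pdf x = normal_peak s * expR (- x ^+ 2 / (s ^+ 2 *+ 2)).
Proof. by rewrite normal_pdfE // /normal_fun subr0. Qed.

Lemma exprn_pdf_le k : exists2 D : R, 0 <= D &
  forall x, `|x ^+ k| * pdf x <= D * normal_pdf 0 (2 * s) x.
Proof.
(* 3/(8 s^2) = 1/(2 s^2) - 1/(8 s^2) is the gap between the exponents for the deviations s and
   2s. *)
have c0 : 0 < 3 / (8 * s ^+ 2) by rewrite divr_gt0 // mulr_gt0 // exprn_gt0.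
have [D D0 hD] := exprn_le_expR k c0.
have s20 : 2 * s != 0 by rewrite mulf_neq0.
have pk : 0 < normal_peak (2 * s) by exact: normal_peak_gt0.
exists (D * normal_peak s / normal_peak (2 * s)) => [|x].
  by rewrite divr_ge0 ?mulr_ge0 ?normal_peak_ge0.
rewrite pdfE normal_pdfE // /normal_fun subr0 normrX.
apply: (@le_trans _ _ (D * expR (3 / (8 * s ^+ 2) * x ^+ 2) *
   (normal_peak s * expR (- x ^+ 2 / (s ^+ 2 *+ 2))))).
  by apply: ler_wpM2r (hD x); rewrite mulr_ge0 ?normal_peak_ge0 ?expR_ge0.
have -> : D * expR (3 / (8 * s ^+ 2) * x ^+ 2) *
   (normal_peak s * expR (- x ^+ 2 / (s ^+ 2 *+ 2))) =
   D * normal_peak s * (expR (3 / (8 * s ^+ 2) * x ^+ 2) * expR (- x ^+ 2 / (s ^+ 2 *+ 2))).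
  by ring.
rewrite -expRD le_eqVlt; apply/orP; left; apply/eqP.
have -> : 3 / (8 * s ^+ 2) * x ^+ 2 + - x ^+ 2 / (s ^+ 2 *+ 2) =
   - x ^+ 2 / ((2 * s) ^+ 2 *+ 2) by field.
by field; rewrite gt_eqF.
Qed.

Lemma measurable_pdf : measurable_fun setT pdf.
Proof. exact: measurable_normal_pdf. Qed.

Lemma integrable_exprn_pdf k : mu.-integrable setT (EFin \o (fun x => x ^+ k * pdf x)).
Proof.
have [D D0 hD] := exprn_pdf_le k.
apply: (@le_integrable _ _ _ mu setT measurableT _
   (EFin \o (fun x => D * normal_pdf 0 (2 * s) x))).
- by apply/measurable_EFinP; apply: measurable_funM => //; exact: measurable_pdf.
- move=> x _ /=; rewrite lee_fin normrM (ger0_norm (normal_pdf_ge0 _ _ _)).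
  by apply: le_trans (hD x) _; exact: ler_norm.
- have -> : EFin \o (fun x => D * normal_pdf 0 (2 * s) x) =
      (fun x => D%:E * (normal_pdf 0 (2 * s) x)%:E)%E by apply/funext => x /=; rewrite EFinM.
  by apply: integrableZl => //; exact: integrable_normal_pdf.
Qed.

Lemma continuous_exprn_pdf k : continuous (fun x : R => x ^+ k * pdf x).
Proof.
move=> x; apply: cvgM; first exact: exprn_continuous.
exact: continuous_normal_pdf.
Qed.

(** One more power is still bounded, which leaves a factor 1/(n+1); [e] is 1 or -1, for the two ends
    of the line. *)
Lemma cvg_exprn_pdf k (e : R) : `|e| = 1 ->
  (fun n : nat => (e * n.+1%:R) ^+ k * pdf (e * n.+1%:R)) @ \oo --> (0 : R).
Proof.
move=> e1; have [D D0 hD] := exprn_pdf_le k.+1.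
have s20 : 2 * s != 0 by rewrite mulf_neq0.
pose B := D * normal_peak (2 * s).
have B0 : 0 <= B by rewrite mulr_ge0 ?normal_peak_ge0.
have cB : (fun n : nat => B / n.+1%:R) @ \oo --> (0 : R).
  by rewrite -[0](mulr0 B); apply: cvgM; [exact: cvg_cst | exact: cvg_harmonic].
apply: (@squeeze_cvgr _ _ _ _ (fun n : nat => - (B / n.+1%:R)) (fun n : nat => B / n.+1%:R)) => //.
- apply: nearW => n.
  have n0 : 0 < (n.+1%:R : R) by rewrite ltr0n.
  rewrite -ler_norml normrM normrX normrM e1 mul1r (ger0_norm (ltW n0)).
  rewrite (ger0_norm (normal_pdf_ge0 _ _ _)) ler_pdivlMr //.
  have := hD (e * n.+1%:R); rewrite normrX normrM e1 mul1r (ger0_norm (ltW n0)) => h.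
  have -> : n.+1%:R ^+ k * pdf (e * n.+1%:R) * n.+1%:R = n.+1%:R ^+ k.+1 * pdf (e * n.+1%:R) :> R.
    by rewrite exprS; ring.
  apply: le_trans h _; apply: ler_wpM2l => //.
  exact: normal_pdf_ub.
- by rewrite -[0]oppr0; apply: cvgN.
Qed.

Lemma is_derive_pdf (x : R) : is_derive x 1 pdf (- x / s ^+ 2 * pdf x).
Proof.
pose Q : {poly R} := - (s ^+ 2 *+ 2)^-1 *: 'X^2.
have -> : pdf = normal_peak s \*: (expR \o horner Q).
  apply/funext => y; rewrite pdfE /= /Q hornerZ hornerXn; congr (_ * expR _).
  by rewrite mulNr mulrC mulNr.
have dQ := is_derive_poly Q x.
have d1 := is_derive1_comp (is_derive_expR Q.[x]) dQ.
apply: is_derive_eq; rewrite /= /Q derivZ derivXn !hornerZ hornerMn !hornerXn /GRing.scale /=.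
by field.
Qed.

Definition ibp_fun k (x : R) : R := k%:R * (x ^+ k.-1 * pdf x) - (s ^+ 2)^-1 * (x ^+ k.+1 * pdf x).

Lemma is_derive_exprn_pdf k (x : R) :
  is_derive x 1 (fun x : R => x ^+ k * pdf x) (ibp_fun k x).
Proof.
have -> : (fun x : R => x ^+ k * pdf x) = horner 'X^k * pdf.
  by apply/funext => y; rewrite /GRing.mul /= hornerXn.
have d1 := is_derive_pdf x.
have d2 := is_derive_poly 'X^k x.
apply: is_derive_eq; rewrite derivXn hornerMn !hornerXn /GRing.scale /= /ibp_fun.
by rewrite [x ^+ k.+1]exprS; field.
Qed.

Lemma continuous_ibp_fun k : continuous (ibp_fun k).
Proof.
move=> x; apply: cvgB; apply: cvgM; by [exact: cvg_cst | exact: continuous_exprn_pdf].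
Qed.

Lemma integrable_ibp_fun k : mu.-integrable setT (EFin \o ibp_fun k).
Proof.
have -> : EFin \o ibp_fun k = (fun x => k%:R%:E * (x ^+ k.-1 * pdf x)%:E -
   (s ^+ 2)^-1%:E * (x ^+ k.+1 * pdf x)%:E)%E by [].
by apply: integrableB => //; apply: integrableZl => //; exact: integrable_exprn_pdf.
Qed.

Lemma ibp_interval k (A : R) : 0 < A ->
  (\int[mu]_(x in `[(- A)%R, A]) (ibp_fun k x)%:E =
   (A ^+ k * pdf A - (- A) ^+ k * pdf (- A))%:E)%E.
Proof.
move=> A0; rewrite (@continuous_FTC2 _ (ibp_fun k) (fun x : R => x ^+ k * pdf x)) //.
- by rewrite gtrN.
- by apply: continuous_subspaceT; exact: continuous_ibp_fun.
- split => [x xI||]; first by apply: ex_derive; exact: is_derive_exprn_pdf.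
  + by apply: cvg_at_right_filter; exact: continuous_exprn_pdf.
  + by apply: cvg_at_left_filter; exact: continuous_exprn_pdf.
- by move=> x xI; rewrite derive1E; apply: derive_val; exact: is_derive_exprn_pdf.
Qed.

(** Over growing intervals the boundary terms tend to 0, and dominated convergence passes to the
    line. *)
Lemma ibp_integral k : (\int[mu]_x (ibp_fun k x)%:E = 0)%E.
Proof.
pose I (n : nat) : set R := `[- n.+1%:R, n.+1%:R].
pose fn n x := ((EFin \o ibp_fun k) \_ (I n)) x.
have mf : measurable_fun setT (EFin \o ibp_fun k).
  exact: measurable_int (integrable_ibp_fun k).
have mI n : measurable (I n) by exact: measurable_itv.
have fnE n : (\int[mu]_x fn n x = ((1 * n.+1%:R) ^+ k * pdf (1 * n.+1%:R) -
   (-1 * n.+1%:R) ^+ k * pdf (-1 * n.+1%:R))%:E)%E.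
  by rewrite -integral_mkcond mul1r mulN1r; apply: ibp_interval; rewrite ltr0n.
have c0 : ([sequence \int[mu]_x fn n x]_n @ \oo --> 0)%E.
  under eq_fun do rewrite fnE.
  apply/fine_cvgP; split; first exact: nearW.
  pose u e (n : nat) : R := (e * n.+1%:R) ^+ k * pdf (e * n.+1%:R).
  have h : (fun n => u 1 n - u (-1) n) @ \oo --> (0 - 0 : R).
    by apply: cvgB; apply: cvg_exprn_pdf; rewrite ?normrN normr1.
  by rewrite subr0 in h; exact: h.
have mfn n : measurable_fun setT (fn n).
  by apply/(measurable_restrictT _ (mI n)) => //; exact: measurable_funTS.
have ff : {ae mu, forall x, setT x -> fn ^~ x @ \oo --> (EFin \o ibp_fun k) x}.
  apply: aeW => x _; apply: cvg_near_cst; near=> n.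
  rewrite /fn patchE mem_set // /I /= in_itv /= -ler_norml.
  apply: (@le_trans _ _ n%:R); last by rewrite ler_nat.
  by near: n; exact: nbhs_infty_ger.
have ig : mu.-integrable setT (fun x => `|(ibp_fun k x)%:E|%E).
  by apply: integrable_abse; exact: integrable_ibp_fun.
have fg : {ae mu, forall x n, setT x -> (`|fn n x| <= `|(ibp_fun k x)%:E|)%E}.
  apply: aeW => x n _; rewrite /fn patchE; case: ifP => //= _.
  by rewrite normr0 lee_fin.
have [] := @dominated_convergence _ _ R mu setT measurableT fn (EFin \o ibp_fun k)
  (fun x => `|(ibp_fun k x)%:E|%E) mfn mf ff ig fg.
move=> _ _ h.
by have := cvg_unique _ h c0; apply.
Unshelve. all: by end_near.
Qed.

Definition gmom a : R := \int[nu]_x (x ^+ a).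

Lemma ge0_integral_normal (f : R -> R) : measurable_fun setT f -> (forall x, 0 <= f x) ->
  (\int[nu]_x (f x)%:E = \int[mu]_x (f x * pdf x)%:E)%E.
Proof.
move=> mf f0; have h : (\int[mu]_x (f x * pdf x)%:E = 1%:E * \int[nu]_x (f x)%:E)%E.
  apply: (@ge0_integral_indep _ _ _ _ (measurableTypeR R) mu id pdf nu 1) => //.
  - exact: measurable_pdf.
  - by move=> w; exact: normal_pdf_ge0.
  - move=> E mE; rewrite mul1e; transitivity (\int[mu]_(x in E) (pdf x)%:E)%E; last by [].
    rewrite [RHS]integral_mkcond.
    apply: eq_integral => x _; rewrite patchE indicE; case: ifP => _ /=.
      by rewrite mul1r.
    by rewrite mul0r.
by rewrite h mul1e.
Qed.

Lemma integrable_exprn_normal a : nu.-integrable setT (EFin \o (fun x => x ^+ a)).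
Proof.
apply/integrableP; split; first by apply/measurable_EFinP.
under eq_integral do rewrite /=.
rewrite (ge0_integral_normal (f := fun x => `|x ^+ a|)) //; last first.
  exact: measurableT_comp.
have /integrableP[_] := integrable_exprn_pdf a.
congr (_ < _)%E; apply: eq_integral => x _ /=.
by rewrite normrM (ger0_norm (normal_pdf_ge0 _ _ _)).
Qed.

Lemma gmomE a : gmom a = \int[mu]_x (x ^+ a * pdf x).
Proof.
rewrite /gmom /Rintegral; congr fine.
have m : measurable_fun setT (EFin \o (fun x : R => x ^+ a)) by apply/measurable_EFinP.
pose f (x : R) : \bar R := (x ^+ a)%:E; pose g (x : R) : \bar R := (x ^+ a * pdf x)%:E.
rewrite -/f -/g [LHS]integralE [RHS]integralE.
have E1 (x : R) : (f ^\+ x = (Num.max (x ^+ a) 0)%:E)%E.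
  by rewrite funeposE /= EFin_max.
have E2 (x : R) : (f ^\- x = (Num.max (- x ^+ a) 0)%:E)%E.
  by rewrite funenegE /= EFin_max.
have E3 (x : R) : (g ^\+ x = (Num.max (x ^+ a) 0 * pdf x)%:E)%E.
  by rewrite funeposE /= -EFin_max maxr_pMl ?mul0r ?normal_pdf_ge0.
have E4 (x : R) : (g ^\- x = (Num.max (- x ^+ a) 0 * pdf x)%:E)%E.
  by rewrite funenegE /= -EFin_max maxr_pMl ?mul0r ?mulNr ?normal_pdf_ge0.
have split_part (h : R -> R) (f1 g1 : R -> \bar R) :
    measurable_fun setT h -> (forall x, 0 <= h x) ->
    (forall x, f1 x = (h x)%:E) -> (forall x, g1 x = (h x * pdf x)%:E) ->
    (\int[nu]_x f1 x = \int[mu]_x g1 x)%E.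
  move=> mh h0 f1E g1E; transitivity (\int[nu]_x (h x)%:E)%E.
    by apply: eq_integral => x _; exact: f1E.
  by rewrite ge0_integral_normal //; apply: eq_integral => x _; rewrite g1E.
congr (_ - _)%E.
  apply: (split_part _ _ _ _ _ E1 E3); first by apply: measurable_maxr.
  by move=> x; rewrite le_max lexx orbT.
apply: (split_part _ _ _ _ _ E2 E4); last by move=> x; rewrite le_max lexx orbT.
by apply: measurable_maxr => //; exact: measurableT_comp.
Qed.

Lemma gmom_rec a : gmom a.+1 = a%:R * s ^+ 2 * gmom a.-1.
Proof.
have := ibp_integral a; rewrite /ibp_fun.
under eq_integral do rewrite EFinB !EFinM.
rewrite integralB //; last 2 first.
- by apply: integrableZl => //; exact: integrable_exprn_pdf.
- by apply: integrableZl => //; exact: integrable_exprn_pdf.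
rewrite !integralZl //; last 2 first.
- exact: integrable_exprn_pdf.
- exact: integrable_exprn_pdf.
rewrite !gmomE /Rintegral.
have f1 := integrable_fin_num measurableT (integrable_exprn_pdf a.-1).
have f2 := integrable_fin_num measurableT (integrable_exprn_pdf a.+1).
rewrite -(fineK f1) -(fineK f2) -!EFinM -EFinB => -[] /eqP.
rewrite subr_eq0 => /eqP h.
rewrite mulrAC [_ * s ^+ 2]mulrC h mulrA divff ?mul1r //.
by rewrite expf_neq0.
Qed.

Lemma gmom0 : gmom 0 = 1.
Proof.
rewrite gmomE /Rintegral; under eq_integral do rewrite expr0 mul1r.
by rewrite integral_normal_pdf.
Qed.
End GaussianMoments.

(** * Mixed moments of independent Gaussians *)

Section Independence.
Local Open Scope classical_set_scope.
Context {R : realType} {d : measure_display} {T : measurableType d}.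
Variables (P : probability T R) (K : finType) (Y : K -> T -> R) (s : R).
Hypothesis s_gt0 : 0 < s.
Hypothesis mY : forall k, measurable_fun setT (Y k).
Hypothesis lawY : forall k (E : set R), measurable E -> P (Y k @^-1` E) = normal_prob 0 s E.
Hypothesis indY : mutually_independent P Y.
Local Notation nu := (normal_prob 0 s).

Lemma measurable_prod_fun (f : K -> R -> R) (A : pred K) :
  (forall k, measurable_fun setT (f k)) ->
  measurable_fun setT (fun w => \prod_(k | A k) f k (Y k w)).
Proof.
move=> mf; have -> : (fun w => \prod_(k | A k) f k (Y k w)) =
    (fun w => \prod_(k <- [seq k <- index_enum K | A k]) f k (Y k w)).
  by apply/funext => w; rewrite big_filter.
elim: [seq _ <- _ | _] => [|k r IH].
  by under eq_fun do rewrite big_nil; exact: measurable_cst.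
under eq_fun do rewrite big_cons.
by apply: measurable_funM => //; exact: measurableT_comp.
Qed.

(** Induction on the coordinates whose factor need not be an indicator. Without any, this is the
    definition of independence; one more is freed by [ge0_integral_indep], with the other factors as
    weight. *)
Lemma ge0_integral_prod (J : seq K) (f : K -> R -> R) (m : K -> R) :
  (forall k, measurable_fun setT (f k)) -> (forall k x, 0 <= f k x) ->
  (forall k, (\int[nu]_x (f k x)%:E = (m k)%:E)%E) ->
  (forall k, k \notin J -> exists2 E : set R, measurable E & f k = \1_E) ->
  (\int[P]_w (\prod_k f k (Y k w))%:E = (\prod_k m k)%:E)%E.
Proof.
elim: J f m => [|j J IH] f m mf f0 fm fi.
  have /choice[E hE] : forall k, exists E : set R, measurable E /\ f k = \1_E.
    by move=> k; have [//|E mE e] := fi k; exists E.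
  pose B := \bigcap_(k in setT) (Y k @^-1` E k).
  have mB : measurable B.
    apply: fin_bigcap_measurable => // k _; rewrite -[_ @^-1` _]setTI.
    by apply: mY => //; exact: (hE k).1.
  have pB w : \prod_k f k (Y k w) = \1_B w.
    rewrite indicE; have [wB|wB] := boolP (w \in B).
      apply: big1 => k _; rewrite (hE k).2 indicE mem_set //.
      by move: wB; rewrite inE => /(_ k I).
    have [k hk] : exists k, ~ E k (Y k w).
      apply/existsNP => h; move/negP: wB; apply; rewrite inE => k _; exact: h.
    by rewrite (bigD1 k) //= (hE k).2 indicE memNset // mul0r.
  under eq_integral do rewrite pB.
  rewrite integral_indic // setIT.
  transitivity (\prod_(k : K) P (Y k @^-1` E k))%E; first exact: (indY (fun k => (hE k).1)).
  rewrite -prodEFin; apply: eq_bigr => k _.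
  rewrite lawY; last exact: (hE k).1.
  rewrite -fm.
  transitivity (\int[nu]_x (\1_(E k) x)%:E)%E.
    by rewrite integral_indic ?setIT //; exact: (hE k).1.
  by apply: eq_integral => x _; rewrite (hE k).2.
pose G w := \prod_(k | k != j) f k (Y k w).
pose kappa := \prod_(k | k != j) m k.
have m0 k : 0 <= m k.
  by rewrite -lee_fin -fm; apply: integral_ge0 => x _; rewrite lee_fin.
have h : (\int[P]_w (f j (Y j w) * G w)%:E = kappa%:E * \int[nu]_x (f j x)%:E)%E.
  apply: (@ge0_integral_indep _ _ _ _ (measurableTypeR R) P (Y j) G nu kappa) => //.
  - exact: mY.
  - exact: measurable_prod_fun.
  - by move=> w; apply: prodr_ge0 => k _.
  - move=> E mE.
    have fin : nu E \is a fin_num by exact: fin_num_measure.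
    pose f' k : R -> R := if k == j then \1_E else f k.
    pose m' k := if k == j then fine (nu E) else m k.
    have := IH f' m'; rewrite /f' /m' (bigD1 j) //= eqxx.
    have -> : \prod_(i | i != j) (if i == j then fine (nu E) else m i) = kappa.
      by apply: eq_bigr => i /negbTE ->.
    rewrite mulrC EFinM fineK // => <-.
    + apply: eq_integral => w _; congr (_%:E); rewrite [RHS](bigD1 j) //= eqxx.
      by congr (_ * _); apply: eq_bigr => i /negbTE ->.
    + by move=> k; case: eqP => // _; exact: measurable_indic.
    + by move=> k x; case: eqP => // _; rewrite indicE ler0n.
    + move=> k; case: eqP => // _; rewrite fineK //.
      by rewrite integral_indic ?setIT.
    + move=> k kJ; case: eqP => [_|/eqP kj]; first by exists E.
      by apply: fi; rewrite inE negb_or kj.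
  - exact: mf.
transitivity (\int[P]_w (f j (Y j w) * G w)%:E)%E.
  by apply: eq_integral => w _; rewrite (bigD1 j).
by rewrite h fm -EFinM mulrC [in RHS](bigD1 j).
Qed.

(** Second induction, on the coordinates of unknown sign: both sides are linear in [f j], which
    splits into positive and negative parts. *)
Lemma integral_prod (J : seq K) (f : K -> R -> R) :
  (forall k, measurable_fun setT (f k)) ->
  (forall k, nu.-integrable setT (EFin \o f k)) ->
  (forall k, k \notin J -> forall x, 0 <= f k x) ->
  P.-integrable setT (EFin \o (fun w => \prod_k f k (Y k w))) /\
  \int[P]_w (\prod_k f k (Y k w)) = \prod_k \int[nu]_x f k x.
Proof.
elim: J f => [|j J IH] f mf fi f0.
  have h : (\int[P]_w (\prod_k f k (Y k w))%:E = (\prod_k \int[nu]_x f k x)%:E)%E.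
    apply: (@ge0_integral_prod (enum K)) => //.
    - by move=> k x; exact: f0.
    - by move=> k; rewrite fineK //; exact: integrable_fin_num (fi k).
    - by move=> k; rewrite mem_enum.
  split; last by rewrite /Rintegral h.
  apply/integrableP; split; first by apply/measurable_EFinP; exact: measurable_prod_fun.
  rewrite (eq_integral (fun w => (\prod_k f k (Y k w))%:E)) ?h ?ltry // => w _ /=.
  by rewrite ger0_norm // prodr_ge0 // => k _; exact: f0.
pose fp k x := if k == j then Num.max (f k x) 0 else f k x.
pose fn k x := if k == j then Num.max (- f k x) 0 else f k x.
have mfp k : measurable_fun setT (fp k).
  by rewrite /fp; case: eqP => // _; apply: measurable_maxr.
have mfn k : measurable_fun setT (fn k).
  rewrite /fn; case: eqP => // _; apply: measurable_maxr => //.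
  exact: measurableT_comp.
have le_i (g : R -> R) k : measurable_fun setT g -> (forall x, `|g x| <= `|f k x|) ->
    nu.-integrable setT (EFin \o g).
  move=> mg gf; apply: (le_integrable measurableT _ _ (fi k)).
    exact/measurable_EFinP.
  by move=> x _ /=; rewrite lee_fin.
have mx (y : R) : `|Num.max y 0| <= `|y|.
  by rewrite maxEle; case: ifP => _; rewrite ?normr0.
have ifp k : nu.-integrable setT (EFin \o fp k).
  by apply: (le_i _ k) => // x; rewrite /fp; case: eqP.
have ifn k : nu.-integrable setT (EFin \o fn k).
  apply: (le_i _ k) => // x; rewrite /fn; case: eqP => // _.
  by rewrite -[leRHS]normrN.
have [|ip ep] := IH fp mfp ifp.
  move=> k kJ x; rewrite /fp; case: eqP => [_|/eqP kj]; first by rewrite le_max lexx orbT.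
  by apply: f0; rewrite inE negb_or kj.
have [|in_ en] := IH fn mfn ifn.
  move=> k kJ x; rewrite /fn; case: eqP => [_|/eqP kj]; first by rewrite le_max lexx orbT.
  by apply: f0; rewrite inE negb_or kj.
have E w : \prod_k f k (Y k w) = \prod_k fp k (Y k w) - \prod_k fn k (Y k w).
  rewrite (bigD1 j) //= [X in _ = X - _](bigD1 j) //= [X in _ = _ - X](bigD1 j) //=.
  rewrite /fp /fn eqxx.
  have e (g : K -> R) : \prod_(i | i != j) (if i == j then g i else f i (Y i w)) =
     \prod_(i | i != j) f i (Y i w) by apply: eq_bigr => i /negbTE ->.
  rewrite !e -mulrBl; congr (_ * _).
  by rewrite !maxEle; case: ifP; case: ifP; lra.
have E2 : \prod_k \int[nu]_x f k x =
    \prod_k \int[nu]_x fp k x - \prod_k \int[nu]_x fn k x.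
  rewrite (bigD1 j) //= [X in _ = X - _](bigD1 j) //= [X in _ = _ - X](bigD1 j) //=.
  have ep' : \prod_(i | i != j) \int[nu]_x fp i x = \prod_(i | i != j) \int[nu]_x f i x.
    by apply: eq_bigr => i /negbTE ij; rewrite /fp ij.
  have en' : \prod_(i | i != j) \int[nu]_x fn i x = \prod_(i | i != j) \int[nu]_x f i x.
    by apply: eq_bigr => i /negbTE ij; rewrite /fn ij.
  rewrite ep' en' -mulrBl; congr (_ * _).
  rewrite -RintegralB //.
  apply: eq_Rintegral => x _; rewrite /fp /fn eqxx.
    by rewrite !maxEle; case: ifP; case: ifP; lra.
have E3 : (fun w => \prod_k f k (Y k w)) =
   (fun w => \prod_k fp k (Y k w) - \prod_k fn k (Y k w)) by apply/funext.
rewrite E3; split; first exact: (integrableB measurableT ip in_).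
by rewrite RintegralB // ep en E2.
Qed.

Definition mono (l : seq K) (w : T) : R := \prod_(k <- l) Y k w.

Lemma monoE l w : mono l w = \prod_k (Y k w) ^+ count_mem k l.
Proof.
rewrite /mono; elim: l => [|x l IH]; first by rewrite big_nil big1.
rewrite big_cons IH (bigD1 x) //= [RHS](bigD1 x) //= eqxx exprS mulrA.
by congr (_ * _); apply: eq_bigr => k /negbTE kx; rewrite eq_sym kx.
Qed.

Definition Em l : R := \int[P]_w mono l w.

Lemma mono_integral l : P.-integrable setT (EFin \o mono l) /\
  Em l = \prod_k gmom s (count_mem k l).
Proof.
rewrite /Em (_ : mono l = fun w => \prod_k (Y k w) ^+ count_mem k l); last first.
  by apply/funext => w; rewrite monoE.
apply: (@integral_prod (enum K) (fun k x => x ^+ count_mem k l)).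
- by move=> k.
- by move=> k; exact: integrable_exprn_normal.
- by move=> k; rewrite mem_enum.
Qed.

Lemma count_dels y (l : seq K) :
  (\sum_(z <- dels l) (z.1 == y))%N = count_mem y l.
Proof.
elim: l => [|x l IH]; first by rewrite big_nil.
by rewrite big_dels_cons /= IH.
Qed.

(** Wick's formula for the first letter: in the product of one-variable moments only the factor of
    [y] changes, and [gmom_rec] gives one term per occurrence of [y] in [l]. *)
Lemma Em_rec y l : Em (y :: l) = \sum_(z <- dels l) (s ^+ 2 *+ (z.1 == y)) * Em z.2.
Proof.
pose Q := gmom s (count_mem y l).-1 * \prod_(k | k != y) gmom s (count_mem k l).
transitivity (\sum_(z <- dels l) (s ^+ 2 * Q) *+ (z.1 == y)).
  rewrite sumrMnr count_dels (mono_integral _).2 (bigD1 y) //= eqxx add1n gmom_rec //.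
  rewrite /Q -[RHS]mulr_natl !mulrA; congr (_ * _).
  by apply: eq_bigr => k /negbTE ky; rewrite eq_sym ky.
rewrite [LHS]big_seq [RHS]big_seq; apply: eq_bigr => z zl.
case: eqP => [zy|_]; last by rewrite mulr0n mul0r.
rewrite !mulr1n; congr (_ * _); rewrite (mono_integral _).2 /Q.
have c k : count_mem k l = ((z.1 == k) + count_mem k z.2)%N.
  by rewrite (permP (dels_perm zl)).
rewrite [RHS](bigD1 y) //= c zy eqxx; congr (_ * _).
by apply: eq_bigr => k /negbTE ky; rewrite c zy eq_sym ky.
Qed.

Lemma Em_nil : Em [::] = 1.
Proof. by rewrite (mono_integral _).2 big1 // => k _; rewrite gmom0. Qed.
End Independence.

(** * From mixed moments to the recursion for words *)

Section WickExpansion.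
Variables (C : numClosedFieldType) (n p : nat).
Local Notation M := 'M['M[C]_n]_p.
Local Notation letter := ('I_n * 'I_n * bool)%type.
Local Notation unitE := (@unitE C n).
Local Notation s2 := (var_n C n).

(* [expand s f] is the word [s] in which the monomial [l] produced by its random
   letters is replaced by [f l]. *)
Fixpoint expand (s : seq (bool * M)) (f : seq letter -> C) : M :=
  if s is (e, N) :: s' then
    \sum_o (unitE e o)%:M *m N *m expand s' (fun l => f (o :: l))
  else ((f [::])%:M)%:M.

Lemma eq_expand s f g : f =1 g -> expand s f = expand s g.
Proof.
elim: s f g => [|[e N] s IH] f g fg /=; first by rewrite fg.
by apply: eq_bigr => o _; congr (_ *m _); apply: IH => l.
Qed.

Lemma expandD s f g : expand s (fun l => f l + g l) = expand s f + expand s g.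
Proof.
elim: s f g => [|[e N] s IH] f g /=; first by rewrite !raddfD.
rewrite -big_split; apply: eq_bigr => o _ /=.
by rewrite -mulmxDr -IH.
Qed.

Lemma expand0 s : expand s (fun=> 0) = 0.
Proof.
elim: s => [|[e N] s IH] /=; first by rewrite !raddf0.
by apply: big1 => o _; rewrite IH mulmx0.
Qed.

Lemma expand_sum (I : Type) (r : seq I) s (F : I -> seq letter -> C) :
  expand s (fun l => \sum_(i <- r) F i l) = \sum_(i <- r) expand s (F i).
Proof.
elim: r => [|i r IH].
  rewrite big_nil -[RHS](expand0 s); apply: eq_expand => l; exact: big_nil.
rewrite big_cons -IH -expandD; apply: eq_expand => l; exact: big_cons.
Qed.

Lemma scalar_comm z (N : M) : (z%:M)%:M *m N = N *m (z%:M)%:M.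
Proof.
by apply/matrixP => k l; rewrite scalar_mulE mul_scalarE mul_scalar_mx mul_mx_scalar.
Qed.

Lemma scalar_letter z (E : 'M[C]_n) (N Q : M) :
  (z *: E)%:M *m N *m Q = E%:M *m N *m ((z%:M)%:M *m Q).
Proof.
have -> : (z *: E)%:M = (z%:M)%:M *m E%:M :> M by rewrite -scalar_mxM -mul_scalar_mx.
by rewrite [RHS]mulmxA -scalar_comm !mulmxA.
Qed.

Lemma expandZ s z f : expand s (fun l => z * f l) = (z%:M)%:M *m expand s f.
Proof.
elim: s f => [|[e N] s IH] f /=; first by rewrite -scalar_mxM -[_ * _%:M]/(_ *m _) -scalar_mxM.
rewrite mulmx_sumr; apply: eq_bigr => o _.
by rewrite (IH (fun l => f (o :: l))) [RHS]mulmxA [_%:M *m (_ *m N)]scalar_comm -[RHS]mulmxA.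
Qed.

Variable m : seq letter -> C.
Hypothesis m_nil : m [::] = 1.
Hypothesis m_rec : forall y l, m (y :: l) = \sum_(z <- dels l) (s2 *+ (z.1 == y)) * m z.2.

(* [V O l] sums over the injections of [O] into [l] that match equal letters; the
   remaining letters of [l] contribute their mixed moment. *)
Fixpoint V (O : seq letter) (l : seq letter) : C :=
  if O is o :: O' then \sum_(z <- dels l) (s2 *+ (z.1 == o)) * V O' z.2 else m l.

(** Either [y] is matched with a letter of [O], or it remains and [m_rec] pairs it with a letter of
    [l], as if it had been opened. *)
Lemma V_cons O y l :
  V O (y :: l) = V (y :: O) l + \sum_(z <- dels O) (s2 *+ (z.1 == y)) * V z.2 l.
Proof.
elim: O l => [|o O IH] l; first by rewrite big_nil addr0 /= m_rec.
rewrite [LHS]/= big_dels_cons /=.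
under eq_bigr do rewrite IH mulrDr.
rewrite big_split /= addrCA [in RHS]big_dels_cons /=; congr (_ + _).
  under eq_bigr do rewrite mulr_sumr.
  under [in RHS]eq_bigr do rewrite mulr_sumr.
  rewrite (dels_swap (fun a b c => (s2 *+ (a == o)) * ((s2 *+ (b == y)) * V O c))).
  by apply: eq_bigr => z _; apply: eq_bigr => u _; rewrite mulrCA.
congr (_ + _); first by rewrite eq_sym.
under eq_bigr do rewrite mulr_sumr.
rewrite exchange_big /=; apply: eq_bigr => u _; rewrite mulr_sumr.
by apply: eq_bigr => z _; rewrite mulrCA.
Qed.

Lemma Cc_expand s O : Cc s O = expand s (V O).
Proof.
elim: s O => [|[e N] s IH] O /=.
  by case: O => [|o O] /=; rewrite ?m_nil // big_nil !raddf0.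
have H o : expand s (fun l => V O (o :: l)) =
    Cc s (o :: O) + \sum_(z <- dels O) ((s2 *+ (z.1 == o))%:M)%:M *m Cc s z.2.
  rewrite (eq_expand _ (fun l => V_cons O o l)) expandD expand_sum -IH; congr (_ + _).
  by apply: eq_bigr => z _; rewrite expandZ IH.
under [RHS]eq_bigr do rewrite H mulmxDr.
rewrite big_split /=; congr (_ + _).
under [RHS]eq_bigr do rewrite mulmx_sumr.
rewrite exchange_big; apply: eq_bigr => z _ /=.
rewrite (bigD1 z.1) //= [X in _ + X]big1 ?addr0 => [|o oz].
  by rewrite eqxx mulr1n scalar_letter.
by rewrite eq_sym (negbTE oz) mulr0n !raddf0 mul0mx mulmx0.
Qed.
End WickExpansion.

(** * Expected words in the Ginibre matrix *)

Section Expectation.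
Local Open Scope sesquilinear_scope.
Context {R : realType} {d : measure_display} {T : measurableType d}.
Variable P : probability T R.
Local Notation C := R[i].
Local Notation Re z := (complex.Re z).
Local Notation Im z := (complex.Im z).

(** Integrability travels with the value, since [Ecomplex] is total and its linearity is only
    available for integrable functions. *)
Definition has_mean (f : T -> C) (z : C) : Prop :=
  [/\ P.-integrable setT (EFin \o (fun w => Re (f w))),
      P.-integrable setT (EFin \o (fun w => Im (f w))) &
      Ecomplex P f = z].

Lemma EcomplexE f : Ecomplex P f =
  Complex (\int[P]_w Re (f w)) (\int[P]_w Im (f w)).
Proof. by rewrite /Ecomplex !unlock. Qed.

Lemma has_meanP f a b : 
  P.-integrable setT (EFin \o (fun w => Re (f w))) ->
  P.-integrable setT (EFin \o (fun w => Im (f w))) ->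
  \int[P]_w Re (f w) = a -> \int[P]_w Im (f w) = b -> has_mean f (Complex a b).
Proof. by move=> i1 i2 <- <-; split => //; rewrite EcomplexE. Qed.

Lemma has_mean_cst z : has_mean (fun=> z) z.
Proof.
case: z => a b; apply: has_meanP => /=.
- exact: finite_measure_integrable_cst.
- exact: finite_measure_integrable_cst.
- by rewrite Rintegral_cst //= probability_setT mulr1.
- by rewrite Rintegral_cst //= probability_setT mulr1.
Qed.

Lemma has_meanD f g x y : has_mean f x -> has_mean g y ->
  has_mean (fun w => f w + g w) (x + y).
Proof.
move=> [f1 f2 <-] [g1 g2 <-]; rewrite !EcomplexE.
have rD : (fun w => Re (f w + g w)) = (fun w => Re (f w) + Re (g w)).
  by apply/funext => w; case: (f w); case: (g w).
have iD : (fun w => Im (f w + g w)) = (fun w => Im (f w) + Im (g w)).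
  by apply/funext => w; case: (f w); case: (g w).
apply: has_meanP; rewrite ?rD ?iD.
- exact: (integrableD measurableT f1 g1).
- exact: (integrableD measurableT f2 g2).
- exact: RintegralD.
- exact: RintegralD.
Qed.

Lemma has_meanZ f x z : has_mean f x -> has_mean (fun w => z * f w) (z * x).
Proof.
move=> [f1 f2 <-]; rewrite !EcomplexE; case: z => a b.
have rM : (fun w => Re (Complex a b * f w)) = (fun w => a * Re (f w) - b * Im (f w)).
  by apply/funext => w; case: (f w).
have iM : (fun w => Im (Complex a b * f w)) = (fun w => a * Im (f w) + b * Re (f w)).
  by apply/funext => w; case: (f w).
have iZ r (h : T -> R) : P.-integrable setT (EFin \o h) ->
    P.-integrable setT (EFin \o (fun w => r * h w)).
  move=> ih; exact: (integrableZl measurableT r ih).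
apply: has_meanP; rewrite ?rM ?iM.
- exact: (integrableB measurableT (iZ a _ f1) (iZ b _ f2)).
- exact: (integrableD measurableT (iZ a _ f2) (iZ b _ f1)).
- by rewrite RintegralB ?RintegralZl //; exact: iZ.
- by rewrite RintegralD ?RintegralZl //; exact: iZ.
Qed.

Lemma has_mean_sum (I : Type) (r : seq I) (f : I -> T -> C) z :
  (forall i, has_mean (f i) (z i)) ->
  has_mean (fun w => \sum_(i <- r) f i w) (\sum_(i <- r) z i).
Proof.
move=> h; elim: r => [|i r IH].
  by rewrite big_nil; under eq_fun do rewrite big_nil; exact: has_mean_cst.
by rewrite big_cons; under eq_fun do rewrite big_cons; exact: has_meanD.
Qed.

Lemma has_mean_real (f : T -> R) : P.-integrable setT (EFin \o f) ->
  has_mean (fun w => (f w)%:C%C) (\int[P]_w f w)%:C%C.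
Proof.
move=> fi; apply: has_meanP => //=.
  exact: finite_measure_integrable_cst.
by rewrite Rintegral_cst // mul0r.
Qed.

Variables (n p : nat).
Hypothesis n_gt0 : (0 < n)%N.
Local Notation M := 'M['M[C]_n]_p.
Local Notation letter := ('I_n * 'I_n * bool)%type.

Lemma mulmx_entry (A B : M) k l a b :
  (A *m B) k l a b = \sum_q \sum_c A k q a c * B q l c b.
Proof. by rewrite mxE summxE; apply: eq_bigr => q _; rewrite mxE. Qed.

Lemma has_mean_mul (A : M) (F : T -> M) (B : M) :
  (forall k l a b, has_mean (fun w => F w k l a b) (B k l a b)) ->
  forall k l a b, has_mean (fun w => (A *m F w) k l a b) ((A *m B) k l a b).
Proof.
move=> h k l a b; under eq_fun do rewrite mulmx_entry.
rewrite mulmx_entry; apply: has_mean_sum => q; apply: has_mean_sum => c.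
exact: has_meanZ.
Qed.

Lemma has_mean_expand (s : seq (bool * M)) (f : seq letter -> T -> C) g :
  (forall l, has_mean (f l) (g l)) -> forall k l a b,
  has_mean (fun w => expand s (fun l => f l w) k l a b) (expand s g k l a b : C) .
Proof.
elim: s f g => [|[e N] s IH] f g h k l a b /=.
  have E z : ((z%:M)%:M : M) k l a b = if (k == l) && (a == b) then z else 0.
    by rewrite !mxE; case: (k == l); rewrite ?mulr1n ?mulr0n ?mxE //; case: (a == b).
  rewrite E; under eq_fun do rewrite E.
  by case: (_ && _); [exact: h | exact: has_mean_cst].
under eq_fun do rewrite summxE summxE.
rewrite summxE summxE; apply: has_mean_sum => o.
apply: (@has_mean_mul _ (fun w => expand s (fun l => f (o :: l) w))) => *.
exact: (IH (fun l => f (o :: l)) (fun l => g (o :: l))).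
Qed.

Variable X : T -> 'M[C]_n.
Hypothesis gX : ginibre P X.
Local Notation Y := (entry_part X).
Local Notation sigma := (Num.sqrt (2 * n%:R)^-1 : R).

Fixpoint xword (Z : 'M[C]_n) (s : seq (bool * M)) : M :=
  if s is (e, N) :: s1 then
    ((if e then Z else Z^t* )%:M) *m N *m xword Z s1
  else 1%:M.

Lemma letters_unitE w e : (if e then X w else (X w)^t* ) =
  \sum_o (Y o w)%:C%C *: unitE C e o.
Proof.
have D (F : 'I_n -> 'I_n -> C) (A : 'I_n -> 'I_n -> 'M[C]_n) e' :
  \sum_(o : letter) (Y o w)%:C%C *: (kap C e' o.2 *: A o.1.1 o.1.2) =
  \sum_a \sum_b (if e' then X w a b else (X w a b)^* ) *: A a b.
  rewrite sum_letter; apply: eq_bigr => a _; apply: eq_bigr => b _.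
  rewrite big_bool /= !scalerA -scalerDl; congr (_ *: _).
  rewrite mulr1 /entry_part /=; case: (X w a b) => x y.
  case: e'.
    by rewrite mulrC -complexiE; simpc.
  by rewrite mulrN mulrC -complexiE; simpc.
rewrite /unitE; case: e.
  rewrite (D (fun _ _ => 0) (fun a b => delta_mx a b) true) [LHS]matrix_sum_delta.
  by [].
rewrite (D (fun _ _ => 0) (fun a b => delta_mx b a) false) [LHS]matrix_sum_delta.
rewrite exchange_big; apply: eq_bigr => a _; apply: eq_bigr => b _.
by rewrite !mxE.
Qed.

Lemma mono_cons o l w : mono Y (o :: l) w = Y o w * mono Y l w.
Proof. by rewrite /mono big_cons. Qed.

Lemma xword_expand w s : xword (X w) s = expand s (fun l => (mono Y l w)%:C%C).
Proof.
elim: s => [|[e N] s IH] /=; first by rewrite /mono big_nil.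
rewrite IH letters_unitE raddf_sum !mulmx_suml; apply: eq_bigr => o _ /=.
rewrite [in RHS](eq_expand _ (fun l => congr1 (@real_complex R) (mono_cons o l w))).
rewrite [in RHS](eq_expand _ (fun l => rmorphM _ _ _)) expandZ.
exact: scalar_letter.
Qed.

Lemma sigma_gt0 : 0 < sigma.
Proof. by rewrite sqrtr_gt0 invr_gt0 mulr_gt0 // ltr0n. Qed.

Lemma sigma2 : (sigma ^+ 2)%:C%C = var_n C n.
Proof.
rewrite sqr_sqrtr ?invr_ge0 ?mulr_ge0 ?ler0n // /var_n /two_n natrM.
by rewrite fmorphV rmorphM !rmorph_nat.
Qed.

(** Without directions the weight [V] is the mixed moment itself, so [Cc_expand] reads as a mean. *)
Lemma mean_xword s k l a b :
  has_mean (fun w => xword (X w) s k l a b) (Cc s [::] k l a b).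
Proof.
have mY := ginibre_measurable gX.
have lY := ginibre_normal gX.
have iY := ginibre_independent gX.
pose m l := (Em P Y l)%:C%C : C.
rewrite (Cc_expand (m := m)).
- under eq_fun do rewrite xword_expand.
  apply: has_mean_expand => L; apply: has_mean_real.
  exact: (mono_integral sigma_gt0 mY lY iY L).1.
- by rewrite /m (Em_nil sigma_gt0 mY lY iY).
- move=> y L; rewrite /m (Em_rec sigma_gt0 mY lY iY) rmorph_sum /=.
  apply: eq_bigr => z _; rewrite rmorphM; congr (_ * _).
  by rewrite -sigma2; case: eqP => _; rewrite ?mulr0n ?mulr1n ?rmorph0.
Qed.

Lemma mean_ptr N0 s k l :
  has_mean (fun w => ptr (N0 *m xword (X w) s) k l) (ptr (Gm (N0, [::]) s) k l).
Proof.
rewrite /Gm (sum_tuple0 (fun O => Rr N0 [::] O *m Cc s O)) /=.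
under eq_fun do rewrite mxE; rewrite mxE; apply: has_meanZ.
apply: has_mean_sum => a.
by apply: has_mean_mul => *; exact: mean_xword.
Qed.

Lemma Emx_ptr N0 s (Z : 'M[C]_p) :
  Emx P (fun w => ptr (N0 *m xword (X w) s) - Z) = ptr (Gm (N0, [::]) s) - Z.
Proof.
apply/matrixP => k l; rewrite mxE; under eq_fun do rewrite mxE.
rewrite [RHS]mxE.
have := has_meanD (mean_ptr N0 s k l) (has_mean_cst ((- Z) k l)).
by case.
Qed.
End Expectation.

(** * Operator norms *)

Section OperatorNorms.
Variable R : realType.
Local Notation C := R[i].

Lemma nrm2_l2norm k (v : 'cV[C]_k) : nrm2 v = (l2norm v ^+ 2)%:C%C.
Proof.
rewrite nrm2_cV /l2norm sqr_sqrtr; last by apply: sumr_ge0 => j _; exact: sqr_ge0.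
by rewrite rmorph_sum; apply: eq_bigr => j _; rewrite rmorphXn.
Qed.

Lemma l2norm_ge0 k (v : 'cV[C]_k) : 0 <= l2norm v.
Proof. exact: sqrtr_ge0. Qed.

Lemma opnorm_le k (B : 'M[C]_k) (K : R) : 0 <= K ->
  (forall y : 'cV_k, nrm2 (B *m y) <= (K ^+ 2)%:C%C * nrm2 y) -> opnorm B <= K.
Proof.
move=> K0 h; apply: ge_sup.
  exists (l2norm (B *m (0 : 'cV_k))), 0 => //=.
  by rewrite /l2norm big1 ?sqrtr0 ?ler01 // => j _; rewrite mxE Normc.normc0 expr0n.
move=> _ [v /= v1 <-].
have := h v; rewrite !nrm2_l2norm -rmorphM lecR -exprMn => hv.
have : l2norm (B *m v) <= K * l2norm v.
  by rewrite -(ler_pXn2r (n := 2)) ?nnegrE ?mulr_ge0 ?l2norm_ge0.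
by move/le_trans; apply; rewrite ler_piMr.
Qed.

Lemma nrm2_mulmx k (B : 'M[C]_k) (v : 'cV[C]_k) : nrm2 (B *m v) <= nrm2 B * nrm2 v.
Proof.
rewrite nrm2_cV {1}/nrm2 mulr_suml; apply: ler_sum => i _.
rewrite mxE nrm2_cV; exact: cauchy_schwarz.
Qed.

Lemma opnorm_lt1 k (B : 'M[C]_k) (v : 'cV[C]_k) : opnorm B < 1 ->
  nrm2 (B *m v) <= nrm2 v.
Proof.
move=> B1.
(* The supremum in [opnorm] dominates its elements only once the set is known to be bounded; the
   Frobenius norm of [B] bounds it. *)
have ub : has_ubound [set l2norm (B *m v) | v in [set v : 'cV_k | l2norm v <= 1]]%classic.
  exists (Num.sqrt (complex.Re (nrm2 B))) => _ [u /= u1 <-].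
  have : nrm2 (B *m u) <= nrm2 B.
    apply: le_trans (nrm2_mulmx _ _) _; rewrite ler_piMr ?nrm2_ge0 //.
    by rewrite nrm2_l2norm -[1]/(1%:C%C) lecR exprn_ile1 // l2norm_ge0.
  rewrite nrm2_l2norm; case: (nrm2 B) => a b; rewrite lecE /= => /andP[_ h].
  by rewrite -(ger0_norm (l2norm_ge0 _)) -sqrtr_sqr ler_sqrt // (le_trans _ h) ?sqr_ge0.
have h1 u : l2norm u <= 1 -> l2norm (B *m u) <= 1.
  move=> u1; apply: le_trans (ltW B1); apply: ub_le_sup => //.
  by exists u.
have [v0|v0] := eqVneq (l2norm v) 0.
  apply: le_trans (nrm2_mulmx _ _) _.
  by rewrite nrm2_l2norm v0 expr0n /= rmorph0 mulr0.
pose z : C := ((l2norm v)^-1)%:C%C.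
have vp : 0 < l2norm v by rewrite lt_def v0 l2norm_ge0.
have nz : `|z| ^+ 2 * (l2norm v ^+ 2)%:C%C = 1.
  rewrite /z normc_def /= expr0n addr0 sqrtr_sqr -rmorphXn -rmorphM /=.
  by rewrite ger0_norm ?invr_ge0 ?l2norm_ge0 // -exprMn mulVf // expr1n.
have zv1 : l2norm (z *: v) <= 1.
  rewrite -(ler_pXn2r (n := 2)) ?nnegrE ?l2norm_ge0 // expr1n -lecR.
  by rewrite -nrm2_l2norm nrm2Z nrm2_l2norm nz.
have := h1 _ zv1; rewrite -(ler_pXn2r (n := 2)) ?nnegrE ?l2norm_ge0 // expr1n -lecR.
rewrite -nrm2_l2norm -scalemxAr nrm2Z => h.
have z0 : 0 < `|z| ^+ 2.
  rewrite exprn_gt0 // normr_gt0 /z; apply/eqP => /(congr1 (@complex.Re R)) /eqP /=.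
  by rewrite invr_eq0 (negbTE v0).
by rewrite -(ler_pM2l z0) (le_trans h) // nrm2_l2norm nz.
Qed.

Variables n p : nat.

Definition stack (u : 'M[C]_(p, n)) : 'cV[C]_(\sum_(k < p) n) :=
  \mxcol_(k < p) (row k u)^T.

Lemma nrm2_stack u : nrm2 (stack u) = nrm2 u.
Proof.
rewrite nrm2_cV; under eq_bigr do rewrite mxE.
rewrite /nrm2 sig_big_dep /= (reindex _ tagnat.sig_bij_on) /=.
by apply: eq_bigr => l _; rewrite !mxE.
Qed.

Lemma block_opnorm_ctr (A : 'M['M[C]_n]_p) : block_opnorm A < 1 -> ctr A.
Proof.
move=> A1; apply: actP_ctr => u; rewrite -!nrm2_stack.
suff -> : stack (act A u) = \mxblock_(k < p, l < p) A k l *m stack u by exact: opnorm_lt1.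
rewrite mul_mxblock_mxrow; apply: eq_mxcol => k.
apply/colP => a; rewrite !mxE summxE; apply: eq_bigr => l _.
by rewrite mxE; apply: eq_bigr => b _; rewrite !mxE.
Qed.
End OperatorNorms.

(** * The two products of the theorem as words *)

Section Alternation.
Variables (M W : pzRingType) (L : M -> W) (x : bool -> W).

Fixpoint gword (s : seq (bool * M)) : W :=
  if s is (e, N) :: s1 then x e * L N * gword s1 else 1.

(* [A_1 x B_1 x^* ... A_m x B_m x^*] is [A_1] times the word [letters B_1 ...]. *)
Fixpoint letters (B : M) (l : seq (M * M)) : seq (bool * M) :=
  (true, B) :: (if l is (A1, B1) :: l1 then (false, A1) :: letters B1 l1
                else [:: (false, 1)]).

Lemma size_letters B l : size (letters B l) = (2 * (size l).+1)%N.
Proof. by elim: l B => [|[A1 B1] l IH] B //=; rewrite IH; lia. Qed.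

Hypothesis L1 : L 1 = 1.

Lemma gword_letters A B l :
  \prod_(z <- (A, B) :: l) (L z.1 * (x true * L z.2 * x false)) =
  L A * gword (letters B l).
Proof.
elim: l A B => [|[A1 B1] l IH] A B.
  by rewrite big_seq1 /= L1 !mulr1.
by rewrite big_cons IH /= !mulrA.
Qed.
End Alternation.

Section Words.
Local Open Scope sesquilinear_scope.
Variables (R : realType) (n p : nat).
Local Notation C := R[i].
Local Notation M := 'M['M[C]_n]_p.

Lemma xword_gword (Z : 'M[C]_n) (s : seq (bool * M)) :
  xword Z s = gword idfun (fun e => (if e then Z else Z^t* )%:M) s.
Proof. by elim: s => [|[e N] s IH] //=; rewrite IH. Qed.

Lemma word_gword (A : algType C) (star : A -> A) (iota : {rmorphism 'M[C]_n -> A}) c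
    (s : seq (bool * M)) :
  word star iota c s = gword (fun N : M => map_mx iota N) (fun e => (xlet star c e)%:M) s.
Proof. by elim: s => [|[e N] s IH] //=; rewrite IH. Qed.

Lemma gaussian_words (X : 'M[C]_n) m (A' B' : 'I_m.+1 -> M) :
  \prod_(i < m.+1) (A' i *m check_mx X (B' i)) =
  A' ord0 *m xword X (letters (B' ord0) [seq (A' (lift ord0 i), B' (lift ord0 i)) | i <- index_enum 'I_m]).
Proof.
rewrite xword_gword -[RHS](gword_letters (L := idfun)) // big_cons big_map big_ord_recl.
by [].
Qed.

Lemma free_words (A : algType C) (star : A -> A) (iota : {rmorphism 'M[C]_n -> A}) c
    m (A' B' : 'I_m.+1 -> M) :
  \prod_(i < m.+1) (map_mx iota (A' i) *m bar_mx star iota c (B' i)) =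
  map_mx iota (A' ord0) *m word star iota c
    (letters (B' ord0) [seq (A' (lift ord0 i), B' (lift ord0 i)) | i <- index_enum 'I_m]).
Proof.
rewrite word_gword -[RHS](gword_letters (L := fun N : M => map_mx iota N)); last exact: map_mx1.
by rewrite big_cons big_map big_ord_recl.
Qed.

Lemma letters_ctr B (l : seq (M * M)) : ctr B ->
  (forall z, z \in l -> ctr z.1 /\ ctr z.2) ->
  forall z, z \in letters B l -> ctr z.2.
Proof.
elim: l B => [|[A1 B1] l IH] B cB cl z /=; rewrite !inE.
  by move=> /orP[/eqP ->|/eqP ->]; [exact: cB | exact: ctr1].
have [cA1 cB1] : ctr A1 /\ ctr B1 by apply: (cl (A1, B1)); rewrite inE eqxx.
case/orP=> [/eqP -> |]; first exact: cB.
case/orP=> [/eqP -> |]; first exact: cA1.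
move: z; apply: (IH B1 cB1) => u ul.
by apply: cl; rewrite inE ul orbT.
Qed.
End Words.

Theorem theorem6 :
  forall (R : realType) (m : nat), (1 <= m)%N ->
  exists C : R,
  forall (N d1 d2 : nat), (0 < N)%N -> (0 < d2)%N -> (d2 < d1)%N ->
  forall n p : nat, n = (N ^ d1)%N -> p = (N ^ d2)%N ->
  forall (d : measure_display) (T : measurableType d) (P : probability T R)
    (X : T -> 'M[R[i]]_n), ginibre P X ->
  forall (A : algType R[i]) (star : A -> A) (tau : {scalar A})
    (iota : {rmorphism 'M[R[i]]_n -> A}) (c : A),
    circular_free_product star tau iota c ->
  forall A' B' : 'I_m -> 'M['M[R[i]]_n]_p,
    (forall i, block_opnorm (A' i) < 1) ->
    (forall i, block_opnorm (B' i) < 1) ->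
    opnorm (Emx P (fun w =>
        map_mx (@ntr R n) (\prod_(i < m) (A' i *m check_mx (X w) (B' i)))
      - map_mx tau
          (\prod_(i < m) (map_mx iota (A' i) *m bar_mx star iota c (B' i)))))
    <= C * N%:R ^ (- d1%:Z + d2%:Z).
Proof.
(* From here [m] is one less than in the statement: the word has [2 * m.+1] letters and starts from
   an empty stack. The square root undoes the squared norms of [genus_bound]. *)
move=> R [//|m] _; exists (Num.sqrt (cD (2 * m.+1) 0)%:R).
move=> N d1 d2 N0 _ _ n p nE pE d T P X gX A star tau iota c hc A' B' hA hB.
have n0 : (0 < n)%N by rewrite nE expn_gt0 N0.
have cA i : ctr (A' i) by exact: block_opnorm_ctr.
have cB i : ctr (B' i) by exact: block_opnorm_ctr.
pose s := letters (B' ord0) [seq (A' (lift ord0 i), B' (lift ord0 i)) | i <- index_enum 'I_m].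
have cs z : z \in s -> ctr z.2.
  move: z; apply: letters_ctr; first exact: cB.
  by move=> u /mapP[i _ ->]; split; [exact: cA | exact: cB].
have sz : size s = (2 * m.+1)%N 
  by rewrite size_letters size_map /index_enum unlock -enumT size_enum_ord.
rewrite [Emx P _](_ : _ = Emx P (fun w =>
   ptr (A' ord0 *m xword (X w) s) - FF star tau iota c (A' ord0, [::]) s)); last first.
  congr (Emx P _); apply/funext => w; rewrite gaussian_words free_words; congr (_ - _).
  by apply/matrixP => k l; rewrite !mxE.
rewrite (Emx_ptr n0 gX).
have pn : (p%:R / n%:R : R) = N%:R ^ (- d1%:Z + d2%:Z).
  have Nu : (N%:R : R) != 0 by rewrite pnatr_eq0 -lt0n.
  by rewrite expfzDr // -exprnN -exprnP nE pE !natrX mulrC.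
rewrite -pn; apply: opnorm_le => [|y]; first by rewrite mulr_ge0 ?sqrtr_ge0 ?divr_ge0 ?ler0n.
apply: nrm2_dual => [|x].
  rewrite mulr_ge0 ?nrm2_ge0 // -[0]/(0%:C%C) lecR; exact: sqr_ge0.
have := genus_bound n0 (FF_nil hc) (FF_step star tau iota c) x y
  (z := (A' ord0, [::])) (conj (cA ord0) (fun z => _)) cs.
rewrite sz [size _]/=; move: (cD _ _) => D h; apply: le_trans (h _) _ => //.
have -> : ((Num.sqrt D%:R * (p%:R / n%:R)) ^+ 2 : R)%:C%C = D%:R * (p%:R / n%:R) ^+ 2.
  rewrite exprMn sqr_sqrtr ?ler0n //.
  by rewrite !(rmorphM, rmorphXn, fmorphV, rmorph_nat).
by rewrite le_eqVlt; apply/orP; left; apply/eqP; ring.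
Qed.
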